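(* Let $A$ and $B$ be two unital Banach algebras, let $A\overline{\otimes}B$ be a Banach algebra that is the completion of the algebraic tensor product $A\otimes B$ with respect to a uniform crossnorm, and consider $a\in A$ and $b\in B$. Set $\mathbb{D}=\sigma(a)\sigma_{DR}(b)\cup\sigma_{DR}(a)\sigma(b)$. Then the following statements hold. (i) If $\sigma(a)=\Pi(a)$ and $\sigma(b)=\Pi(b)$, then $\mathbb{D}=\emptyset=\sigma_{DR}(a\otimes b)$. (ii) If $\sigma_{DR}(a)\neq\emptyset$ or $\sigma_{DR}(b)\neq\emptyset$, then $\sigma_{DR}(a\otimes b)\setminus\{0\}=\mathbb{D}\setminus\{0\}$ and $\sigma_{DR}(a\otimes b)\subseteq\mathbb{D}$.
   Context: Banach algebras are complex. A norm on $A\otimes B$ is a crossnorm if $\|x\otimes y\|=\|x\|\,\|y\|$ for $x\in A$, $y\in B$; it is uniform if $\|(U\otimes V)z\|\le\|U\|\,\|V\|\,\|z\|$ for all bounded linear maps $U$ on $A$, $V$ on $B$ and all $z\in A\otimes B$. The element $a\otimes b$ is regarded as an element of the Banach algebra $A\overline{\otimes}B$. For $K,L\subseteq\mathbb{C}$, $KL=\{kl: k\in K,\ l\in L\}$ (empty if $K$ or $L$ is empty). An element $x$ of a unital Banach algebra $C$ is Drazin invertible if there exist $y\in C$ and $m\in\mathbb{N}$ (with $m\ge0$ allowed) such that $x^myx=x^m$, $yxy=y$ and $xy=yx$. The Drazin spectrum of $x$ is $\sigma_{DR}(x)=\{\lambda\in\mathbb{C}: x-\lambda\text{ is not Drazin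 invertible in }C\}$. $\sigma(x)$ is the usual spectrum and $\mathrm{iso}\,\sigma(x)$ is the set of its isolated points. $\Pi(x)\subseteq\mathrm{iso}\,\sigma(x)$ is the set of poles of $x$: those $\lambda_0\in\mathrm{iso}\,\sigma(x)$ that are poles of some finite order $p\ge1$ of the resolvent function $R(\cdot,x)$, i.e. in the Laurent expansion $R(\lambda,x)=\sum_{n\ge0}a_n(\lambda-\lambda_0)^n+\sum_{n\ge1}b_n(\lambda-\lambda_0)^{-n}$ around $\lambda_0$ one has $b_p\ne0$ and $b_m=0$ for all $m\ge p+1$. *)

(* Defs.v *)
From HB Require Import structures.
From mathcomp Require Import all_boot all_order all_algebra.
From mathcomp Require Import all_classical all_reals all_analysis.
From mathcomp Require Export complex.

Set Implicit Arguments.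
Unset Strict Implicit.
Unset Printing Implicit Defensive.

Import Order.TTheory GRing.Theory Num.Theory numFieldNormedType.Exports.
Local Open Scope classical_set_scope.
Local Open Scope ring_scope.
Local Open Scope complex_scope.

(* Unital Banach algebras. Hierarchy-Builder accepts no structure joining normed
   modules and rings over an arbitrary scalar field (it would have to precede
   [numDomainType]), so the product is a field of a record, and the ring
   structures are then declared on the carrier [ba_sort], next to the normed
   module one. The unit is nonzero, but [`|1| = 1] is not required. *)
Record banachAlgType (K : numFieldType) := BanachAlg {
  ba_base : completeNormedModType K ;
  ba_mul : ba_base -> ba_base -> ba_base ;
  ba_one : ba_base ;
  ba_mulA : associative ba_mul ;
  ba_mul1 : left_id ba_one ba_mul ;
  ba_mulr1 : right_id ba_one ba_mul ;
  ba_mulDl : left_distributive ba_mul +%R ;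
  ba_mulDr : right_distributive ba_mul +%R ;
  ba_one_neq0 : ba_one != 0 ;
  ba_scaleAl : forall (k : K) x y, k *: ba_mul x y = ba_mul (k *: x) y ;
  ba_scaleAr : forall (k : K) x y, k *: ba_mul x y = ba_mul x (k *: y) ;
  ba_normM_le : forall x y, `|ba_mul x y| <= `|x| * `|y|
}.

Definition ba_sort (K : numFieldType) (A : banachAlgType K) : Type :=
  CompleteNormedModule.sort (ba_base A).
Coercion ba_sort : banachAlgType >-> Sortclass.

Section banach_algebra_structures.
Context {K : numFieldType} {A : banachAlgType K}.

HB.instance Definition _ := CompleteNormedModule.copy (ba_sort A) (ba_base A).
HB.instance Definition _ := GRing.Zmodule_isNzRing.Build (ba_sort A)
  (@ba_mulA K A) (@ba_mul1 K A) (@ba_mulr1 K A)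
  (@ba_mulDl K A) (@ba_mulDr K A) (@ba_one_neq0 K A).
HB.instance Definition _ :=
  GRing.Lmodule_isLalgebra.Build K (ba_sort A) (@ba_scaleAl K A).
HB.instance Definition _ :=
  GRing.Lalgebra_isAlgebra.Build K (ba_sort A) (@ba_scaleAr K A).

(* [GRing.unit] is two-sided invertibility in [A]. *)
Let ba_unit : pred A := [pred x : A | `[< exists y, y * x = 1 /\ x * y = 1 >]].
Let ba_inv (x : A) : A :=
  if pselect (exists y, y * x = 1 /\ x * y = 1) is left ex
  then projT1 (cid ex) else x.

Let ba_mulVr : {in ba_unit, left_inverse 1 ba_inv *%R}.
Proof.
move=> x /asboolP ex; rewrite /ba_inv; case: pselect => // ex'.
by case: cid => y [].
Qed.

Let ba_mulrV : {in ba_unit, right_inverse 1 ba_inv *%R}.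
Proof.
move=> x /asboolP ex; rewrite /ba_inv; case: pselect => // ex'.
by case: cid => y [].
Qed.

Let ba_unitP (x y : A) : y * x = 1 /\ x * y = 1 -> ba_unit x.
Proof. by move=> xy; apply/asboolP; exists y. Qed.

Let ba_inv_out : {in [predC ba_unit], ba_inv =1 id}.
Proof. by move=> x /asboolP nex; rewrite /ba_inv; case: pselect. Qed.

HB.instance Definition _ := GRing.NzRing_hasMulInverse.Build (ba_sort A)
  ba_mulVr ba_mulrV ba_unitP ba_inv_out.

Lemma normrM_le (x y : A) : `|x * y| <= `|x| * `|y|.
Proof. exact: ba_normM_le. Qed.

End banach_algebra_structures.

Section spectra.
Context {K : numFieldType} {A : banachAlgType K}.
Implicit Types (x : A) (l : K).

Definition spectrum x : set K := [set l | x - l%:A \isn't a GRing.unit].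

(* [m] may be 0, so invertible elements are Drazin invertible. *)
Definition drazin_invertible x : Prop :=
  exists (y : A) (m : nat),
    [/\ x ^+ m * y * x = x ^+ m, y * x * y = y & x * y = y * x].

Definition drazin_spectrum x : set K :=
  [set l | ~ drazin_invertible (x - l%:A)].

Definition resolvent l x : A := (l%:A - x)^-1.

(* The resolvent of [x] has, on a punctured disc around [l0], the Laurent
   expansion with regular coefficients [c n] (n >= 0) and singular coefficients
   [b n] (n >= 1); the value [b 0] is not used. Since [^-1] is total, that the
   punctured disc avoids the spectrum is stated explicitly. *)
Definition resolvent_laurent x l0 (c b : nat -> A) : Prop :=
  \forall l \near l0^', ~ spectrum x l /\
    exists s t : A,
      [/\ series (fun n => (l - l0) ^+ n *: c n) @ \oo --> s,
          series (fun n => (l - l0) ^- n.+1 *: b n.+1) @ \oo --> t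
        & resolvent l x = s + t].

Definition poles x : set K :=
  [set l0 | isolated (spectrum x) l0 /\
    exists c b : nat -> A, resolvent_laurent x l0 c b /\
      exists p : nat,
        [/\ (1 <= p)%N, b p != 0 & forall m, (p.+1 <= m)%N -> b m = 0]].

End spectra.

Definition mulset {K : numFieldType} (X Y : set K) : set K :=
  [set k * l | k in X & l in Y].

(* [tens] exhibits [T] as the algebraic tensor product of [A] and [B]. *)
Definition is_tensor_product {K : numFieldType} {A B T : lmodType K}
    (tens : {bilinear A -> B -> T}) : Prop :=
  forall (V : lmodType K) (f : {bilinear A -> B -> V}),
    (exists h : {linear T -> V}, forall x y, h (tens x y) = f x y) /\
    (forall h1 h2 : {linear T -> V},
       (forall x y, h1 (tens x y) = f x y) ->
       (forall x y, h2 (tens x y) = f x y) -> h1 =1 h2).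

Definition is_crossnorm {K : numFieldType} {A B T : normedModType K}
    (tens : {bilinear A -> B -> T}) : Prop :=
  forall x y, `|tens x y| = `|x| * `|y|.

Definition bounded_linear {K : numFieldType} {V W : normedModType K}
    (U : {linear V -> W}) : Prop :=
  exists M : K, forall x, `|U x| <= M * `|x|.

(* Norms of modules over [R[i]] take values in [R[i]]; the operator norm is
   taken in [R]. *)
Definition opnorm {R : realType} {V W : normedModType R[i]}
    (U : {linear V -> W}) : R :=
  inf [set M : R | 0 <= M /\ forall x, `|U x| <= M%:C * `|x|].

(* When [tens] is a tensor product, [W] below is the map [U (x) V]. *)
Definition is_uniform {R : realType} {A B T : normedModType R[i]}
    (tens : {bilinear A -> B -> T}) : Prop :=
  forall (U : {linear A -> A}) (V : {linear B -> B}) (W : {linear T -> T}),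
    bounded_linear U -> bounded_linear V ->
    (forall x y, W (tens x y) = tens (U x) (V y)) ->
    forall z, `|W z| <= (opnorm U * opnorm V)%:C * `|z|.

Definition is_completion {K : numFieldType} {T : normedModType K}
    {C : completeNormedModType K} (iota : {linear T -> C}) : Prop :=
  (forall z, `|iota z| = `|z|) /\ dense (range iota).

(* The Banach algebra [AB], together with [iota : T -> AB], is a completion of
   the algebraic tensor product of [A] and [B] for a uniform crossnorm, the norm
   of [T], and its product extends (x (x) y)(x' (x) y') = xx' (x) yy'. *)
Record is_banach_tensor {R : realType} {A B AB : banachAlgType R[i]}
    {T : normedModType R[i]} (tens : {bilinear A -> B -> T})
    (iota : {linear T -> AB}) : Prop := {
  banach_tensor_alg : is_tensor_product tens ;
  banach_tensor_cross : is_crossnorm tens ;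
  banach_tensor_uniform : is_uniform tens ;
  banach_tensor_completion : is_completion iota ;
  banach_tensor_mul : forall x x' y y',
    iota (tens x y) * iota (tens x' y') = iota (tens (x * x') (y * y'))
}.

(* Main.v *)
(* To see that the Drazin spectrum of [a (x) b] is contained in [D], let
   [X := a (x) b - l] with [l \notin D], and let [Q] be the bicommutant of
   [a (x) 1] and [1 (x) b]. The [z] in [Q] such that
   [z * X ^+ m \in X ^+ m.+1 * Q] for some [m] form an ideal, which contains [X].
   If it were proper, Gelfand-Mazur modulo an ideal, applied twice, would give
   [mu] and [nu] such that it stays proper when [a (x) 1 - mu] and
   [1 (x) b - nu] are added. Then [mu * nu = l], both [a - mu] and [b - nu] are
   Drazin invertible, and the product of their spectral idempotents lies in the
   ideal while being 1 modulo the two added elements. Hence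
   [X ^+ m \in X ^+ m.+1 * Q] for some [m].

   Conversely let [X] be Drazin invertible with [l = mu * nu] nonzero and
   [b - nu] not invertible. A functional [phi] with [phi 1 != 0] vanishing on
   [(b - nu) B] or on [B (b - nu)] gives, by uniformity of the norm, a bounded
   slice map [id (x) phi], which turns the multiplication by [X] into the one by
   [nu * (a - mu)], and hence the equation [X ^+ m = X ^+ m.+1 * Y] into
   [c ^+ m = c ^+ m.+1 * u] with [c := a - mu]: thus [a - mu] is Drazin
   invertible.

   Comparing Laurent coefficients shows that [x - l0] is Drazin invertible when
   [l0] is a pole of [x]; this gives (i). *)
Require Import Defs.
From HB Require Import structures.
From mathcomp Require Import all_boot all_order all_algebra.
From mathcomp Require Import all_classical all_reals all_analysis.
From mathcomp Require Import ring lra.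

Set Implicit Arguments.
Unset Strict Implicit.
Unset Printing Implicit Defensive.

Import Order.TTheory GRing.Theory Num.Theory numFieldNormedType.Exports.
Local Open Scope classical_set_scope.
Local Open Scope ring_scope.
Local Open Scope complex_scope.

(** * Drazin inverses *)

Section drazin_algebra.
Context {K : numFieldType} {A : banachAlgType K}.
Implicit Types c u d z : A.

Lemma expr_absorb c u m j : c ^+ m = c ^+ m.+1 * u ->
  c ^+ m = c ^+ (m + j) * u ^+ j.
Proof.
move=> cu; elim: j => [|j IH]; first by rewrite addn0 mulr1.
by rewrite {1}IH addnC exprD {1}cu mulrA -exprD addnS addnC -mulrA -exprS addnS.
Qed.

(** The element [u] need not satisfy [u * c * u = u]; replacing it by [c ^+ m * u ^+ m.+1] restores
    this equation and keeps the other two. *)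
Lemma drazin_invertible_comm c u m :
  c ^+ m = c ^+ m.+1 * u -> GRing.comm c u -> drazin_invertible c.
Proof.
move=> cu cuC; exists (c ^+ m * u ^+ m.+1), m.
have cX k l : c ^+ k * u ^+ l = u ^+ l * c ^+ k.
  by apply/commrX/commr_sym/commrX/commr_sym.
have key : c ^+ (m + m).+1 * u ^+ m.+1 = c ^+ m.
  by rewrite -addnS -expr_absorb.
have cy : c * (c ^+ m * u ^+ m.+1) = c ^+ m * u ^+ m.+1 * c.
  by rewrite -mulrA -(cX 1 _ : c * _ = _) mulrA -exprS mulrA -exprSr.
split => //.
- by rewrite -mulrA -cy !mulrA -exprSr -exprD addSn.
- rewrite -cy [c * _]mulrA -exprS cX mulrA -(mulrA _ (c ^+ m.+1)) -exprD.
  by rewrite addSn cX -mulrA key.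
Qed.

Lemma drazin_invertibleP c : drazin_invertible c ->
  exists d m, [/\ c ^+ m = c ^+ m.+1 * d, GRing.comm c d & d * c * d = d].
Proof.
move=> [d [m [cm dcd cd]]]; exists d, m; split=> //.
by rewrite exprSr -mulrA cd mulrA cm.
Qed.

(* The idempotent [e := c * d] commutes with [z], since [e = c ^+ k * d ^+ k]
   for every [k > 0] while [c ^+ k * (1 - e) = 0] for large [k]. *)
Lemma drazin_inverse_bicomm c d m z :
    c ^+ m = c ^+ m.+1 * d -> GRing.comm c d -> d * c * d = d ->
  GRing.comm c z -> GRing.comm d z.
Proof.
move=> cm cd dcd cz; set e := c * d.
have ee : e * e = e by rewrite /e mulrA -(mulrA c) -cd !mulrA -(mulrA c) cd -mulrA dcd.
have eX k : e = c ^+ k.+1 * d ^+ k.+1.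
  rewrite -exprMn_comm // -/e; elim: k => [//|k IH].
  by rewrite exprS -IH ee.
have dX k l : c ^+ k * d ^+ l = d ^+ l * c ^+ k.
  by apply/commrX/commr_sym/commrX/commr_sym.
have zX k : c ^+ k * z = z * c ^+ k by apply/commr_sym/commrX/commr_sym.
have ce : c ^+ m.+1 * e = c ^+ m.+1.
  by rewrite /e mulrA -exprSr [c ^+ m.+2]exprS -mulrA -cm -exprS.
have ec : e * c ^+ m.+1 = c ^+ m.+1.
  rewrite -{2}ce /e; apply: commrX; apply: commr_sym.
  by rewrite /GRing.comm -mulrA -cd.
have ez : e * z = e * z * e.
  rewrite {1 2}(eX m) dX -!mulrA (mulrA (c ^+ m.+1) z e) !zX.
  by rewrite -mulrA ce.
have ze : z * e = e * z * e.
  rewrite {1 3}(eX m) -mulrA !(mulrA z) -!zX.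
  by rewrite !mulrA ec.
have dce : d * e = d by rewrite /e mulrA dcd.
have ed : e * d = d by rewrite /e cd dcd.
(* Since [e] commutes with [z], one gets [d * z = d * z * e = d * c * z * d = e * z * d = z * e * d
   = z * d]. *)
rewrite /GRing.comm -{1}dce -mulrA ez -ze.
have -> : d * (z * e) = d * (z * c) * d by rewrite /e !mulrA.
by rewrite -cz (mulrA d) -cd -/e ez -ze -mulrA ed.
Qed.
End drazin_algebra.
(** * Norms and seminorms with real values *)

Section real_valued_norm.
Context {R : realType}.

(** The order of [R[i]] is only partial; with norms moved to [R], infima and real arithmetic become
    available. *)
Definition rnorm {V : normedZmodType R[i]} (x : V) : R := complex.Re `|x|.

Lemma rnormE (V : normedZmodType R[i]) (x : V) : `|x| = (rnorm x)%:C.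
Proof. by rewrite /rnorm RRe_real // ger0_real. Qed.

Lemma rnorm_ge0 (V : normedZmodType R[i]) (x : V) : 0 <= rnorm x.
Proof. by rewrite -ler0c -rnormE. Qed.

Lemma rnorm0 (V : normedZmodType R[i]) : rnorm (0 : V) = 0.
Proof. by rewrite /rnorm normr0. Qed.

Lemma rnorm_eq0 (V : normedZmodType R[i]) (x : V) : (rnorm x == 0) = (x == 0).
Proof. by rewrite -(normr_eq0 x) rnormE -(inj_eq (@complexI R)). Qed.

Lemma ler_rnormD (V : normedZmodType R[i]) (x y : V) :
  rnorm (x + y) <= rnorm x + rnorm y.
Proof. by rewrite -lecR rmorphD /= -!rnormE ler_normD. Qed.

Lemma rnormN (V : normedZmodType R[i]) (x : V) : rnorm (- x) = rnorm x.
Proof. by rewrite /rnorm normrN. Qed.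

Lemma rnormB (V : normedZmodType R[i]) (x y : V) : rnorm (x - y) = rnorm (y - x).
Proof. by rewrite -rnormN opprB. Qed.

Lemma ler_rnormB_trans (V : normedZmodType R[i]) (y x z : V) :
  rnorm (x - z) <= rnorm (x - y) + rnorm (y - z).
Proof. by rewrite -{1}(subrK y x) -addrA; exact: ler_rnormD. Qed.

Lemma rnorm_realc (t : R) : rnorm (t%:C : R[i]) = `|t|.
Proof.
by rewrite /rnorm normc_def /= expr0n addr0 sqrtr_sqr.
Qed.

Lemma rnorm1c : rnorm (1 : R[i]) = 1.
Proof. by rewrite -(rmorph1 (real_complex R)) rnorm_realc normr1. Qed.

Lemma rnormMc (z w : R[i]) : rnorm (z * w) = rnorm z * rnorm w.
Proof. by apply: (@complexI R); rewrite rmorphM /= -!rnormE normrM. Qed.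

Lemma rnormXc (z : R[i]) n : rnorm (z ^+ n) = rnorm z ^+ n.
Proof. by elim: n => [|n IH]; rewrite ?rnorm1c // !exprS rnormMc IH. Qed.

Lemma rnormZ (V : normedModType R[i]) (c : R[i]) (x : V) :
  rnorm (c *: x) = rnorm c * rnorm x.
Proof. by apply: (@complexI R); rewrite rmorphM /= -!rnormE normrZ. Qed.

Lemma rnormM_le (A : banachAlgType R[i]) (x y : A) :
  rnorm (x * y) <= rnorm x * rnorm y.
Proof. by rewrite -lecR rmorphM /= -!rnormE normrM_le. Qed.

Lemma rnorm_lt_iff (V : normedZmodType R[i]) (x : V) (M : R) :
  (`|x| < M%:C) = (rnorm x < M).
Proof. by rewrite rnormE ltcR. Qed.

End real_valued_norm.
Section quotient_seminorm.
Context {R : realType} {V : lmodType R[i]}.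
Implicit Types (p : V -> R) (J : set V).

Definition seminorm p : Prop :=
  (forall x y, p (x + y) <= p x + p y) /\
  (forall (c : R[i]) x, p (c *: x) = rnorm c * p x).

Section theory.
Variables (p : V -> R) (psn : seminorm p).

Lemma seminormD x y : p (x + y) <= p x + p y. Proof. exact: psn.1. Qed.

Lemma seminormZ c x : p (c *: x) = rnorm c * p x. Proof. exact: psn.2. Qed.

Lemma seminorm0 : p 0 = 0.
Proof. by rewrite -(scale0r 0) seminormZ rnorm0 mul0r. Qed.

Lemma seminormN x : p (- x) = p x.
Proof. by rewrite -scaleN1r seminormZ rnormN rnorm1c mul1r. Qed.

Lemma seminormB x y : p (x - y) <= p x + p y.
Proof. by rewrite -(seminormN y) seminormD. Qed.

Lemma seminorm_ge0 x : 0 <= p x.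
Proof.
have := seminormB x x; rewrite subrr seminorm0 -mulr2n pmulrn_lge0 //.
Qed.

Lemma seminorm_eq0D x y : p x = 0 -> p y = 0 -> p (x + y) = 0.
Proof.
move=> px py; apply/eqP; rewrite eq_le seminorm_ge0 andbT.
by have := seminormD x y; rewrite px py addr0.
Qed.

Lemma seminorm_eq0B x y : p x = 0 -> p y = 0 -> p (x - y) = 0.
Proof. by move=> px py; apply: seminorm_eq0D => //; rewrite seminormN. Qed.

Lemma seminorm_cong x y : p (x - y) = 0 -> p x <= p y.
Proof.
by move=> pxy; have := seminormD (x - y) y; rewrite subrK pxy add0r.
Qed.

End theory.

Definition linear_subspace J : Prop :=
  J 0 /\ forall (c : R[i]) x y, J x -> J y -> J (c *: x + y).

(** This distance to [J] is the seminorm of the quotient by [J], pulled back to [V], so that no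
    quotient space is formed. *)
Definition quotient_seminorm p J x : R := inf [set p (x - j) | j in J].

Section quotient.
Variables (p : V -> R) (J : set V) (psn : seminorm p) (Jsub : linear_subspace J).
Local Notation q := (quotient_seminorm p J).

Lemma subspaceD x y : J x -> J y -> J (x + y).
Proof. by move=> Jx Jy; rewrite -(scale1r x); exact: Jsub.2. Qed.

Lemma subspaceZ c x : J x -> J (c *: x).
Proof. by move=> Jx; rewrite -[_ *: _]addr0; apply: Jsub.2 => //; exact: Jsub.1. Qed.

Let has_inf_q x : has_inf [set p (x - j) | j in J].
Proof.
split; first by exists (p (x - 0)); exists 0 => //; exact: Jsub.1.
by exists 0 => _ [j _ <-]; exact: seminorm_ge0.
Qed.

Lemma quotient_seminorm_le x j : J j -> q x <= p (x - j).
Proof. by move=> Jj; apply: (ge_inf (has_inf_q x).2); exists j. Qed.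

Lemma quotient_seminorm_approx x e : 0 < e -> exists2 j, J j & p (x - j) < q x + e.
Proof.
by move=> e0; have [_ [j Jj <-] jlt] := inf_adherent e0 (has_inf_q x); exists j.
Qed.

Lemma quotient_seminorm_ge x r : (forall j, J j -> r <= p (x - j)) -> r <= q x.
Proof.
by move=> rp; apply: lb_le_inf (has_inf_q x).1 _ => _ [j Jj <-]; exact: rp.
Qed.

Lemma quotient_seminorm_eq0 j : J j -> q j = 0.
Proof.
move=> Jj; apply/eqP; rewrite eq_le; apply/andP; split.
  by rewrite (le_trans (quotient_seminorm_le _ Jj)) // subrr seminorm0.
by apply: quotient_seminorm_ge => k _; exact: seminorm_ge0.
Qed.

Lemma quotient_seminorm_le_base x : q x <= p x.
Proof. by rewrite -{2}(subr0 x); apply: quotient_seminorm_le; exact: Jsub.1. Qed.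

Lemma quotient_seminormP : seminorm q.
Proof.
have qZ c x : rnorm c * q x <= q (c *: x).
  have [->|c0] := eqVneq c 0.
    rewrite rnorm0 mul0r scale0r; apply: quotient_seminorm_ge => j _.
    exact: seminorm_ge0.
  apply: quotient_seminorm_ge => j Jj.
  have -> : c *: x - j = c *: (x - c^-1 *: j).
    by rewrite scalerBr scalerA divff // scale1r.
  rewrite seminormZ // ler_wpM2l ?rnorm_ge0 //.
  by apply: quotient_seminorm_le; exact: subspaceZ.
split=> [x y|c x].
  apply/ler_addgt0Pr => e e0; have e2 : 0 < e / 2 by rewrite divr_gt0.
  have [j Jj jx] := quotient_seminorm_approx x e2.
  have [k Jk ky] := quotient_seminorm_approx y e2.
  have := quotient_seminorm_le (x + y) (subspaceD Jj Jk).
  have := seminormD psn (x - j) (y - k); rewrite addrACA -opprD.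
  by move=> ? ?; lra.
apply/eqP; rewrite eq_le qZ andbT.
have [->|c0] := eqVneq c 0.
  by rewrite scale0r rnorm0 mul0r quotient_seminorm_eq0 //; exact: Jsub.1.
have r0 : 0 < rnorm c by rewrite lt_def rnorm_eq0 c0 rnorm_ge0.
(* The inequality [qZ] for [c^-1] and [c *: x] is the converse of [qZ] for [c] and [x]. *)
have := qZ c^-1 (c *: x); rewrite scalerA mulVf // scale1r.
rewrite -(ler_pM2l r0) mulrA -rnormMc divff // rnorm1c mul1r //.
Qed.

End quotient.
End quotient_seminorm.
(** * Gelfand-Mazur for seminormed algebras *)

Section disc.
Context {R : realType}.

Lemma rnorm_i : rnorm ('i%C : R[i]) = 1.
Proof. by rewrite /rnorm normc_def /= expr0n add0r expr1n sqrtr1. Qed.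

Lemma ler_rnorm_ReIm (z : R[i]) :
  rnorm z <= `|complex.Re z| + `|complex.Im z|.
Proof.
rewrite {1}[z]complexE; apply: le_trans (ler_rnormD _ _) _.
by rewrite rnormMc rnorm_i mul1r !rnorm_realc.
Qed.

Lemma ler_Re_rnorm (z : R[i]) : `|complex.Re z| <= rnorm z.
Proof. by rewrite -lecR -rnormE normc_ge_Re. Qed.

Lemma ler_Im_rnorm (z : R[i]) : `|complex.Im z| <= rnorm z.
Proof.
have := ler_Re_rnorm (z * 'i%C); rewrite rnormMc rnorm_i mulr1.
by rewrite ReiNIm normrN.
Qed.

(** The disc lies in a square of the real plane. Its compactness, in near-covering form along the
    filter of large bounds, merges the local bounds into one. *)
Lemma locally_bounded_disc (f : R[i] -> R) :
    (forall w, exists2 d, 0 < d &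
       exists C, forall z, rnorm (z - w) < d -> f z <= C) ->
  forall r, exists M, forall z, rnorm z <= r -> f z <= M.
Proof.
move=> floc r.
have cpt : compact (`[(- r), r]%classic `*` `[(- r), r]%classic : set (R * R)).
  by apply: compact_setX; exact: segment_compact.
have /compact_near_coveringP cov := cpt.
have := cov R (pinfty_nbhs R) (fun M x => f (x.1 +i* x.2) <= M) _ _.
case=> [x _|M [Mreal bM]].
  have [d d0 [C fC]] := floc (x.1 +i* x.2).
  have d2 : 0 < d / 2 by rewrite divr_gt0.
  exists (ball x (d / 2), [set M | C <= M]) => /=.
    split; first exact: nbhsx_ballx.
    by exists C; split; [exact: num_real|move=> M /ltW].
  move=> [y M] /= [[xy1 xy2] CM]; apply: le_trans CM; apply: fC.
  apply: le_lt_trans (ler_rnorm_ReIm _) _ => /=.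
  rewrite (splitr d) ltrD // distrC.
    by move: xy1.
  by move: xy2.
exists (M + 1) => z zr.
have := bM (M + 1) _ (complex.Re z, complex.Im z); rewrite ltrDl ltr01.
case: z zr => u v zr; apply => //.
by split; rewrite /= in_itv /= -ler_norml (le_trans _ zr) //;
  [exact: (ler_Re_rnorm (u +i* v))|exact: (ler_Im_rnorm (u +i* v))].
Qed.

End disc.

Section gelfand_mazur.
Context {R : realType} {Q : comAlgType R[i]}.
Variables (p : Q -> R) (psn : seminorm p).
Hypothesis pM : forall x y, p (x * y) <= p x * p y.

Let p_ge0 x : 0 <= p x. Proof. exact: seminorm_ge0. Qed.

Let nullM x y : p x = 0 -> p (y * x) = 0.
Proof.
by move=> px; apply/eqP; rewrite eq_le p_ge0 andbT -(mulr0 (p y)) -px pM.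
Qed.

Lemma seminormX x n : p (x ^+ n.+1) <= p x ^+ n.+1.
Proof.
elim: n => [//|n IH]; rewrite exprS (exprS _ n.+1).
by rewrite (le_trans (pM _ _)) // ler_wpM2l.
Qed.

Lemma seminorm1_ge1 : 0 < p 1 -> 1 <= p 1.
Proof. by move=> p1; have := pM 1 1; rewrite mulr1 ler_pMl. Qed.

(** Multiplying [z] by [w] changes the sign of [z ^+ (2 ^ k)] and keeps the modulus: this drives the
    averaging below. *)
Lemma root_minus_one k : exists2 w : R[i], w ^+ (2 ^ k) = -1 & rnorm w = 1.
Proof.
elim: k => [|k [w wk w1]].
  by exists (-1) => //; rewrite rnormN rnorm1c.
exists (sqrtc w); first by rewrite expnS exprM sqr_sqrtc.
have : rnorm (sqrtc w) ^+ 2 = 1 by rewrite -rnormXc sqr_sqrtc.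
by move/eqP; rewrite sqrp_eq1 ?rnorm_ge0 // => /eqP.
Qed.

Section resolvent.
Variables (x : Q) (f : R[i] -> Q).
Hypothesis fP : forall z, p ((1 - z *: x) * f z - 1) = 0.

(** The resolvent equation modulo the null space of [p]: the left-hand element is a combination of
    the defects of [f z] and [f w] as inverses. *)
Lemma resolvent_identity z w :
  p (f z - f w - (z - w) *: (x * (f z * f w))) = 0.
Proof.
have -> : f z - f w - (z - w) *: (x * (f z * f w)) =
    f w * ((1 - z *: x) * f z - 1) - f z * ((1 - w *: x) * f w - 1).
  rewrite !mulrBl !mul1r !mulrBr !mulr1 scalerBl -!scalerAl -!scalerAr.
  rewrite [f w * (x * _)]mulrCA [f z * (x * _)]mulrCA [f w * f z]mulrC.
  set s := z *: _; set t := w *: _; set c := f z * f w.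
  ring.
by apply: seminorm_eq0B => //; apply: nullM.
Qed.

Lemma resolvent_dist z w :
  p (f z - f w) <= rnorm (z - w) * (p x * (p (f z) * p (f w))).
Proof.
apply: le_trans (seminorm_cong psn (resolvent_identity z w)) _.
rewrite seminormZ // ler_wpM2l ?rnorm_ge0 // (le_trans (pM _ _)) //.
by rewrite ler_wpM2l.
Qed.

(** In the estimate of [f z - f w] the factor [p (f z)] recurs on the right. Near [w] its
    coefficient there is at most [1 / 2], so that [p (f z) <= 2 * p (f w)]. *)
Lemma resolvent_bounded r : exists M, forall z, rnorm z <= r -> p (f z) <= M.
Proof.
apply: locally_bounded_disc => w.
pose c := p x * p (f w); have c0 : 0 <= c by rewrite mulr_ge0.
exists (2 * (c + 1))^-1; first by rewrite invr_gt0; lra.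
exists (2 * p (f w)) => z zw.
have h1 := resolvent_dist z w.
have h2 : p (f z) <= p (f w) + p (f z - f w).
  by have := seminormD psn (f w) (f z - f w); rewrite addrC subrK addrC.
have h3 : rnorm (z - w) * c <= 1 / 2.
  have c1 : 0 < 2 * (c + 1) by lra.
  move: zw; rewrite -[_^-1]mul1r ltr_pdivlMr //.
  have := rnorm_ge0 (z - w); nra.
have h4 : rnorm (z - w) * (p x * (p (f z) * p (f w))) =
  p (f z) * (rnorm (z - w) * c) by rewrite /c; ring.
have h5 : p (f z) * (rnorm (z - w) * c) <= p (f z) * (1 / 2) by rewrite ler_wpM2l.
lra.
Qed.

(* Each step averages over the two square roots of the previous variable, so
   that bounds and Lipschitz constants of [f] carry over to every level. *)
Lemma averaged_resolvent r M L :
    (forall z, rnorm z <= r -> p (f z) <= M) ->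
    (forall z w, rnorm z <= r -> rnorm w <= r ->
       p (f z - f w) <= L * rnorm (z - w)) ->
  forall k, exists F : R[i] -> Q,
    [/\ forall z, p ((1 - (z *: x) ^+ (2 ^ k)) * F z - 1) = 0,
        forall z, rnorm z <= r -> p (F z) <= M
      & forall z w, rnorm z <= r -> rnorm w <= r ->
          p (F z - F w) <= L * rnorm (z - w)].
Proof.
move=> fM fL; elim=> [|k [F [FP FM FL]]].
  by exists f; split => // z; rewrite expn0 expr1.
have [v vk v1] := root_minus_one k.
have vr z : rnorm (v * z) = rnorm z by rewrite rnormMc v1 mul1r.
have half : rnorm (2^-1 : R[i]) = 2^-1.
  have -> : (2^-1 : R[i]) = (2^-1 : R)%:C by rewrite fmorphV rmorph_nat.
  by rewrite rnorm_realc ger0_norm // invr_ge0.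
(* With [u := (z *: x) ^+ (2 ^ k)], [F z] inverts [1 - u] and [F (v * z)] inverts [1 + u]; the mean
   of these inverses inverts [1 - u ^+ 2]. *)
exists (fun z => 2^-1 *: (F z + F (v * z))); split.
- move=> z; set u := (z *: x) ^+ (2 ^ k).
  have -> : (z *: x) ^+ (2 ^ k.+1) = u ^+ 2 by rewrite expnSr exprM.
  have := FP (v * z); rewrite -scalerA exprZn vk scaleN1r opprK -/u => h.
  have -> : (1 - u ^+ 2) * (2^-1 *: (F z + F (v * z))) - 1 =
      2^-1 *: ((1 + u) * ((1 - u) * F z - 1) +
               (1 - u) * ((1 + u) * F (v * z) - 1)).
    rewrite -scalerAr -[X in _ - X](scale1r 1).
    rewrite -{2}(mulVf (_ : 2 != 0 :> R[i])) ?pnatr_eq0 //.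
    rewrite -scalerA -scalerBr; congr (_ *: _).
    rewrite scaler_nat; ring.
  rewrite seminormZ // seminorm_eq0D ?mulr0 //; apply: nullM => //.
  exact: FP.
- move=> z zr; rewrite seminormZ // half.
  have := seminormD psn (F z) (F (v * z)).
  have := FM _ zr; have : p (F (v * z)) <= M by apply: FM; rewrite vr.
  lra.
- move=> z w zr wr; rewrite -scalerBr opprD addrACA seminormZ // half.
  have := seminormD psn (F z - F w) (F (v * z) - F (v * w)).
  have := FL _ _ zr wr.
  have : p (F (v * z) - F (v * w)) <= L * rnorm (z - w).
    by rewrite -(vr (z - w)) mulrBr; apply: FL; rewrite vr.
  lra.
Qed.

(** A small power at [t] puts the averaged resolvent near [1] there. The Lipschitz constant is the
    same at every level, so it is still near [1] at [t'], which in turn forces the power at [t'] to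
    be small. *)
Lemma powers_shrink_step r M L t t' :
    (forall z, rnorm z <= r -> p (f z) <= M) ->
    (forall z w, rnorm z <= r -> rnorm w <= r ->
       p (f z - f w) <= L * rnorm (z - w)) ->
    `|t| <= r -> `|t'| <= r -> L * `|t' - t| <= 1 / 6 ->
    (exists k, p ((t%:C *: x) ^+ (2 ^ k)) <= 1 / 2) ->
  exists k, p ((t'%:C *: x) ^+ (2 ^ k)) <= 1 / 2.
Proof.
move=> fM fL tr t'r Ltt' [k]; set y := _ ^+ _ => y2.
have M0 : 0 <= M by apply: le_trans (p_ge0 (f t%:C)) (fM _ _); rewrite rnorm_realc.
(* After [j] further squarings, the power at [t] is small even against the bound [M] of the averaged
   resolvent. *)
have [j jM] : exists j, (1 / 2) ^+ (2 ^ j) * M <= 1 / 6.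
  have M6 : 0 <= 6 * M by lra.
  have := archi_boundP M6; set j := Num.bound _ => jM; exists j.
  rewrite expr_div_n expr1n mul1r mulrC ler_pdivrMr ?exprn_gt0 //.
  suff : j%:R <= 2 ^+ (2 ^ j) :> R by lra.
  rewrite -natrX ler_nat ltnW //.
  by apply: (@ltn_trans (2 ^ j)); exact: ltn_expl.
have [F [FP FM FL]] := averaged_resolvent fM fL (k + j).
exists (k + j)%N; set y' := _ ^+ _.
have yj : p ((t%:C *: x) ^+ (2 ^ (k + j))) <= (1 / 2) ^+ (2 ^ j).
  rewrite expnD exprM -/y; have := expn_gt0 2 j; case: (2 ^ j)%N => // n _.
  by rewrite (le_trans (seminormX _ _)) // lerXn2r ?nnegrE //; lra.
have F1 : p (F t%:C - 1) <= 1 / 6.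
  have := FP t%:C; set yK := _ ^+ _ in yj * => FP1.
  have : p (F t%:C - 1) <= p (yK * F t%:C).
    by apply: seminorm_cong => //; rewrite -FP1; congr p; ring.
  move=> /le_trans; apply; apply: le_trans (pM _ _) _; apply: le_trans jM.
  by rewrite ler_pM // FM // rnorm_realc.
have F2 : p (F t'%:C - F t%:C) <= 1 / 6.
  apply: le_trans (FL _ _ _ _) _; rewrite ?rnorm_realc //.
  by rewrite -rmorphB rnorm_realc.
have F3 : p (F t'%:C - 1) <= 1 / 3.
  have := seminormD psn (F t'%:C - F t%:C) (F t%:C - 1); rewrite addrA subrK; lra.
(* Here [(1 - y') * F = 1] is rewritten as [y' = (F - 1) - y' * (F - 1)], modulo the null space;
   with [p (F - 1) <= 1 / 3] this yields [p y' <= 1 / 2]. *)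
have F4 : p y' <= p ((F t'%:C - 1) - y' * (F t'%:C - 1)).
  apply: seminorm_cong => //; rewrite -[RHS](FP t'%:C) -/y' -seminormN //.
  by congr p; ring.
have F5 := seminormB psn (F t'%:C - 1) (y' * (F t'%:C - 1)).
have F6 := pM y' (F t'%:C - 1).
have F7 : p y' * p (F t'%:C - 1) <= p y' * (1 / 3) by rewrite ler_wpM2l.
lra.
Qed.

(** The point [t] is reached from [0], where the powers vanish, in [n] equal steps;
    [n > 6 * (L * t)] makes each short enough for [powers_shrink_step]. *)
Lemma powers_shrink t : 0 <= t ->
  exists k, p ((t%:C *: x) ^+ (2 ^ k)) <= 1 / 2.
Proof.
move=> t0; have [M fM] := resolvent_bounded t.
have M0 : 0 <= M by apply: le_trans (p_ge0 (f 0)) (fM _ _); rewrite rnorm0.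
pose L := p x * (M * M); have L0 : 0 <= L by rewrite !mulr_ge0.
have fL z w : rnorm z <= t -> rnorm w <= t -> p (f z - f w) <= L * rnorm (z - w).
  move=> zt wt; apply: le_trans (resolvent_dist z w) _.
  rewrite mulrC ler_wpM2r ?rnorm_ge0 // ler_wpM2l // ler_pM //; exact: fM.
have Lt : 0 <= 6 * (L * t) by rewrite !mulr_ge0.
have := archi_boundP Lt; set n := Num.bound _ => nL.
have n0 : 0 < n%:R :> R by apply: le_lt_trans nL.
suff H i : (i <= n)%N ->
    exists k, p (((i%:R * (t / n%:R))%:C *: x) ^+ (2 ^ k)) <= 1 / 2.
  have := H n (leqnn n); rewrite mulrCA divff ?mulr1 //.
  by apply: lt0r_neq0.
have iabs j : (j <= n)%N -> `|j%:R * (t / n%:R)| <= t.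
  move=> jn; rewrite ger0_norm ?mulr_ge0 ?invr_ge0 ?ler0n //.
  by rewrite mulrCA ler_piMr // ler_pdivrMr // mul1r ler_nat.
elim: i => [_|i IH lin].
  by exists 0%N; rewrite mul0r scale0r expr0n /= seminorm0 //; lra.
apply: powers_shrink_step fM fL (iabs _ _) (iabs _ _) _ (IH _) => //; try exact: ltnW.
rewrite -mulrBl -natrB // subSnn (mul1r (t / _)) ger0_norm ?divr_ge0 ?ler0n //.
rewrite mulrA ler_pdivrMr //; lra.
Qed.

End resolvent.

(** Were every [x - mu%:A] invertible modulo the null space, the powers of every multiple of [x]
    would become small, against the invertibility of [x] itself. *)
Lemma gelfand_mazur x : 0 < p 1 ->
  exists mu : R[i], forall u, p ((x - mu%:A) * u - 1) <> 0.
Proof.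
move=> p1; apply: contrapT => /forallNP nmu.
have {nmu} /choice[g gP] mu : exists u, p ((x - mu%:A) * u - 1) = 0.
  by have /existsNP[u /contrapT up] := nmu mu; exists u.
(* For nonzero [z], [1 - z *: x] is [- z] times [x - z^-1]; at [0] the inverse is [1]. *)
pose f z := if z == 0 then 1 else - z^-1 *: g z^-1.
have fP z : p ((1 - z *: x) * f z - 1) = 0.
  rewrite /f; have [->|z0] := eqVneq z 0.
    by rewrite scale0r subr0 mulr1 subrr seminorm0.
  rewrite -(gP z^-1); congr (p (_ - _)).
  rewrite -scalerAr scalerAl scalerBr scalerA mulNr mulVf // scaleN1r opprK.
  by rewrite scaleNr addrC.
(* As [t] exceeds [p (g 0)], smallness of a power of [t *: x] gives seminorm at most [1 / 2] to the
   same power of [x * g 0]. That power equals [1] modulo the null space, while [p 1 >= 1]. *)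
pose t := p (g 0) + 1.
have t0 : 0 <= t by rewrite addr_ge0.
have [k] := powers_shrink fP t0.
have := expn_gt0 2 k; case: (2 ^ k)%N => // n _ tx.
have := gP 0; rewrite scale0r subr0 => xg.
have xgn : p (1 - (x * g 0) ^+ n.+1) = 0.
  rewrite -seminormN // opprB -(expr1n _ n.+1) subrXX mulrC.
  exact: nullM.
have h1 := seminorm_cong psn xgn.
have h2 : t ^+ n.+1 * p ((x * g 0) ^+ n.+1) <= 1 / 2 * t ^+ n.+1.
  have -> : t ^+ n.+1 = rnorm (t%:C ^+ n.+1 : R[i]).
    by rewrite rnormXc rnorm_realc ger0_norm.
  rewrite -seminormZ // exprMn scalerAl -exprZn (le_trans (pM _ _)) //.
  rewrite rnormXc rnorm_realc ger0_norm // ler_pM //.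
  by rewrite (le_trans (seminormX _ _)) // lerXn2r ?nnegrE // lerDl.
have h3 : 0 < t ^+ n.+1 by rewrite exprn_gt0 // ltr_pwDr.
have h4 := seminorm1_ge1 p1.
have : p ((x * g 0) ^+ n.+1) <= 1 / 2 by move: h2; rewrite mulrC ler_pM2r.
lra.
Qed.

End gelfand_mazur.
(** * Drazin invertibility of products of commuting elements *)

Section ideals.
Context {R : realType} {Q : comAlgType R[i]}.
Implicit Types J : set Q.

Definition ideal J : Prop := linear_subspace J /\ forall x j, J j -> J (x * j).

Definition extend_ideal J x : set Q :=
  [set z | exists j u, J j /\ z = j + x * u].

Lemma extend_ideal_ideal J x : ideal J -> ideal (extend_ideal J x).
Proof.
move=> [[J0 JZD] JM]; split; first split.
- by exists 0, 0; rewrite mulr0 addr0.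
- move=> c _ _ [j [u [Jj ->]]] [k [v [Jk ->]]].
  exists (c *: j + k), (c *: u + v); split; first exact: JZD.
  by rewrite scalerDr mulrDr scalerAr addrACA.
- move=> y _ [j [u [Jj ->]]]; exists (y * j), (y * u).
  by split; [exact: JM|rewrite mulrDr [y * (x * u)]mulrCA].
Qed.

Lemma sub_extend_ideal J x : J `<=` extend_ideal J x.
Proof. by move=> j Jj; exists j, 0; rewrite mulr0 addr0. Qed.

Lemma mem_extend_ideal J x : ideal J -> extend_ideal J x x.
Proof. by move=> [[J0 _] _]; exists 0, 1; rewrite mulr1 add0r. Qed.

Section normed.
Variables (p : Q -> R) (psn : seminorm p).
Hypothesis pM : forall x y, p (x * y) <= p x * p y.
Hypothesis invertible_near1 : forall z, p (1 - z) < 1 -> exists w, z * w = 1.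

Lemma quotient_seminormM J : ideal J -> forall x y,
  quotient_seminorm p J (x * y) <=
  quotient_seminorm p J x * quotient_seminorm p J y.
Proof.
move=> [Jsub JM] x y; set q := quotient_seminorm p J.
have qsn : seminorm q by exact: quotient_seminormP.
have qx := seminorm_ge0 qsn x; have qy := seminorm_ge0 qsn y.
apply/ler_addgt0Pr => e e0.
(* The excess of [(q x + d) * (q y + d)] over [q x * q y] is [d * (q x + q y + d)], at most [e]
   because [d <= 1]. *)
pose d := Num.min 1 (e / (q x + q y + 1)).
have s0 : 0 < q x + q y + 1 by lra.
have d0 : 0 < d by rewrite lt_min ltr01 divr_gt0.
have d1 : d <= 1 by rewrite ge_min lexx.
have de : d * (q x + q y + 1) <= e.
  by rewrite -ler_pdivlMr // ge_min lexx orbT.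
have [j Jj jx] := quotient_seminorm_approx psn Jsub x d0.
have [k Jk ky] := quotient_seminorm_approx psn Jsub y d0.
have Jjk : J (x * k + (y - k) * j) by apply: subspaceD => //; exact: JM.
have := quotient_seminorm_le psn Jsub (x * y) Jjk; rewrite -/q.
have -> : x * y - (x * k + (y - k) * j) = (x - j) * (y - k) by ring.
have px := seminorm_ge0 psn (x - j); have py := seminorm_ge0 psn (y - k).
have := pM (x - j) (y - k).
have : p (x - j) * p (y - k) <= (q x + d) * (q y + d).
  by rewrite ler_pM // ltW.
by move=> ? ? ?; nra.
Qed.

(** Elements closer than 1 to [1] are invertible, so a proper ideal has distance at least 1 from
    [1]. Hence [gelfand_mazur] applies to the distance to [J]. *)
Lemma proper_extend_ideal J x : ideal J -> ~ J 1 ->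
  exists mu : R[i], ~ extend_ideal J (x - mu%:A) 1.
Proof.
move=> Jid J1; have [Jsub JM] := Jid.
have qsn := quotient_seminormP psn Jsub.
have q1 : 0 < quotient_seminorm p J 1.
  apply: lt_le_trans ltr01 _; apply: quotient_seminorm_ge => // j Jj.
  rewrite leNgt; apply/negP => /invertible_near1[w jw].
  by apply: J1; rewrite -jw mulrC; exact: JM.
have [mu nmu] := gelfand_mazur qsn (quotient_seminormM Jid) x q1.
exists mu => -[j [u [Jj E]]]; apply: (nmu u).
have -> : (x - mu%:A) * u - 1 = - j by rewrite {2}E; ring.
by rewrite seminormN // quotient_seminorm_eq0.
Qed.

Lemma strongly_pi_regular_mul x y (l : R[i]) :
    (forall mu nu : R[i], mu * nu = l ->
       [\/ exists u : Q, (x - mu%:A) * u = 1,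
           exists v : Q, (y - nu%:A) * v = 1
         | (exists (d : Q) m, (x - mu%:A) ^+ m = (x - mu%:A) ^+ m.+1 * d) /\
           (exists (d : Q) m, (y - nu%:A) ^+ m = (y - nu%:A) ^+ m.+1 * d)]) ->
  exists m (u : Q), (x * y - l%:A) ^+ m = (x * y - l%:A) ^+ m.+1 * u.
Proof.
move=> H; set X := x * y - l%:A.
pose J : set Q := [set z | exists m u, z * X ^+ m = X ^+ m.+1 * u].
have Jid : ideal J.
  split; first split.
  - by exists 0%N, 0; rewrite mul0r mulr0.
  - move=> c z w [m [u zu]] [n [v wv]].
    exists (m + n)%N, (c *: u + v).
    rewrite exprS !exprD mulrDl mulrDr -!scalerAl -!scalerAr.
    have -> : z * (X ^+ m * X ^+ n) = z * X ^+ m * X ^+ n by ring.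
    have -> : w * (X ^+ m * X ^+ n) = w * X ^+ n * X ^+ m by ring.
    by rewrite zu wv !exprS; congr (_ *: _ + _); ring.
  - by move=> z w [m [u wu]]; exists m, (z * u); rewrite -mulrA wu mulrCA.
have [|J1] := pselect (J 1).
  by move=> [m [u mu]]; exists m, u; rewrite -mu mul1r.
exfalso; have [mu Jmu] := proper_extend_ideal x Jid J1.
have Jid' := extend_ideal_ideal (x - mu%:A) Jid.
have [nu Jnu] := proper_extend_ideal y Jid' Jmu.
set K := extend_ideal _ (y - nu%:A) in Jnu.
have Kid : ideal K by exact: extend_ideal_ideal.
have Kx : K (x - mu%:A) by apply: sub_extend_ideal; exact: mem_extend_ideal.
have Ky : K (y - nu%:A) by exact: mem_extend_ideal.
have JK z : J z -> K z by move=> Jz; do 2 apply: sub_extend_ideal.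
have [Ksub KM] := Kid.
have KX : K X by apply: JK; exists 0%N, 1; rewrite expr0 expr1.
have KMr z w : K z -> K (z * w) by move=> Kz; rewrite mulrC; exact: KM.
have KN z : K z -> K (- z) by move=> Kz; rewrite -scaleN1r; exact: subspaceZ.
have [E|E] := eqVneq (mu * nu) l; last first.
  apply: Jnu.
  (* Modulo [K] one has [x = mu], [y = nu] and [x * y = l], so [K] contains the scalar
     [mu * nu - l], here nonzero. *)
  have -> : 1 = (mu * nu - l)^-1 *: (X - (x - mu%:A) * y - mu *: (y - nu%:A)).
    rewrite /X mulrBl -scalerAl mul1r (scalerBr mu) (scalerA mu).
    have -> : x * y - l%:A - (x * y - mu *: y) - (mu *: y - (mu * nu)%:A) =
      (mu * nu)%:A - l%:A by ring.
    by rewrite -scalerBl scalerA mulVf ?scale1r // subr_eq0.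
  apply: subspaceZ => //; apply: subspaceD => //.
    by apply: subspaceD => //; apply: KN; exact: KMr.
  by apply: KN; exact: subspaceZ.
case: (H _ _ E) => [[u xu]|[v yv]|[[d [m dm]] [e [n en]]]].
- by apply: Jnu; rewrite -xu; exact: KMr.
- by apply: Jnu; rewrite -yv; exact: KMr.
set c := x - mu%:A in Kx dm *; set f := y - nu%:A in Ky en *.
have cd0 : c ^+ m * (1 - c * d) = 0.
  by rewrite mulrBr mulr1 mulrA -exprSr -dm subrr.
have fe0 : f ^+ n * (1 - f * e) = 0.
  by rewrite mulrBr mulr1 mulrA -exprSr -en subrr.
have XE : X = c * y + mu *: f.
  rewrite /c /f /X mulrBl -scalerAl mul1r (scalerBr mu) (scalerA mu) E addrA.
  by rewrite subrK.
(* Modulo [c], [X] is [mu *: f]. *)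
have [g gE] : exists g, X ^+ n - (mu *: f) ^+ n = c * g.
  exists (y * \sum_(i < n) X ^+ (n.-1 - i) * (mu *: f) ^+ i).
  by rewrite subrXX mulrA XE addrK.
(* As [f ^+ n] kills [1 - f * e], the product [(1 - f * e) * X ^+ n] is a multiple of [c]. Its
   [m]-th power contains [c ^+ m], which [1 - c * d] kills, so [w * X ^+ (n * m) = 0]. The exponent
   [m] provides one factor [1 - f * e] for each [X ^+ n]. *)
pose w := (1 - c * d) * (1 - f * e) ^+ m.
have Jw : J w.
  exists (n * m)%N, 0; rewrite mulr0 /w -mulrA exprM -exprMn.
  have -> : (1 - f * e) * X ^+ n = c * (g * (1 - f * e)).
    rewrite -[X ^+ n](subrK ((mu *: f) ^+ n)) gE exprZn mulrDr.
    by rewrite -scalerAr [_ * f ^+ n]mulrC fe0 scaler0 addr0; ring.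
  by rewrite exprMn mulrA [_ * c ^+ m]mulrC cd0 mul0r.
apply: Jnu; rewrite -(subrK w 1); apply: subspaceD => //; last exact: JK.
have -> : 1 - w = (1 - (1 - f * e) ^+ m) + c * (d * (1 - f * e) ^+ m).
  by rewrite /w; ring.
apply: subspaceD => //; last exact: KMr.
by rewrite -{1}(expr1n _ m) subrXX opprB addrC subrK -mulrA; exact: KMr.
Qed.

End normed.
End ideals.

(** * Completeness: geometric convergence and the Neumann series *)

Section completeness.
Context {R : realType}.

Lemma geometric_le0 (a C q : R) : 0 <= q < 1 -> (forall n, a <= C * q ^+ n) -> a <= 0.
Proof.
move=> /andP[q0 q1] aC.
have q1' : `|q| < 1 by rewrite ger0_norm.
have h := @cvg_geometric R C q q1'; rewrite -(cvg_lim _ h) //.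
by apply: limr_ge; [exact: cvgP h|apply: nearW => n; exact: aC].
Qed.

(** The rate is kept in the conclusion: the Neumann series and the extension of maps to a completion
    both compare the limit with the [n]-th term. *)
Lemma cauchy_geometric_cvg (V : completeNormedModType R[i]) (u : nat -> V) (C q : R) :
    0 <= q < 1 ->
    (forall n m, (n <= m)%N -> rnorm (u m - u n) <= C * q ^+ n) ->
  exists l, forall n, rnorm (l - u n) <= C * q ^+ n.
Proof.
move=> q01 uC; have /andP[q0 q1] := q01.
have q1' : `|q| < 1 by rewrite ger0_norm.
have ucvg : cvg (u @ \oo).
  apply/cauchy_cvgP/cauchy_ballP => e e0; rewrite near_simpl.
  have eE : e = (complex.Re e)%:C by rewrite RRe_real // gtr0_real.
  have re0 : 0 < complex.Re e by rewrite -ltcR -eE.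
  have e2 : 0 < complex.Re e / 2 by rewrite divr_gt0.
  have /cvgrPdist_lt/(_ _ e2)[N _ HN] := @cvg_geometric R C q q1'.
  have HN' n : (N <= n)%N -> C * q ^+ n < complex.Re e / 2.
    move=> /HN /=; rewrite sub0r normrN; apply: le_lt_trans; exact: ler_norm.
  exists ([set n | (N <= n)%N], [set n | (N <= n)%N]) => /=.
    by split; exists N.
  move=> [n m] [/= nN mN]; rewrite -ball_normE /ball_ /= eE rnorm_lt_iff.
  apply: le_lt_trans (ler_rnormB_trans (u N) _ _) _.
  rewrite (splitr (complex.Re e)) rnormB ltrD //.
    by rewrite rnormB; apply: le_lt_trans (uC _ _ nN) (HN' _ _).
  by rewrite rnormB; apply: le_lt_trans (uC _ _ mN) (HN' _ _).
exists (lim (u @ \oo)) => n; apply/ler_addgt0Pr => e e0.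
have e0' : 0 < e%:C by rewrite ltcR.
have /cvgrPdist_lt/(_ _ e0')[N _ HN] := ucvg.
have /= := HN (maxn n N) (leq_maxr _ _); rewrite rnorm_lt_iff => h.
have := uC n (maxn n N) (leq_maxl _ _).
have := ler_rnormB_trans (u (maxn n N)) (lim (u @ \oo)) (u n).
lra.
Qed.

Lemma invertible_near1 (A : banachAlgType R[i]) (x : A) :
  rnorm (1 - x) < 1 -> exists y, x * y = 1 /\ y * x = 1.
Proof.
set z := 1 - x; set q := rnorm z => q1.
have q01 : 0 <= q < 1 by rewrite rnorm_ge0.
have /andP[q0 _] := q01.
(* The norm of [1] may exceed 1 and enters the bounds as a constant. *)
pose N1 := rnorm (1 : A); have N10 : 0 <= N1 by exact: rnorm_ge0.
have zn n : rnorm (z ^+ n) <= N1 * q ^+ n.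
  elim: n => [|n IH]; first by rewrite !expr0 mulr1.
  rewrite !exprSr mulrA (le_trans (rnormM_le _ _)) // ler_wpM2r //.
pose u n := \sum_(k < n) z ^+ k.
have dq : 0 < 1 - q by rewrite subr_gt0.
have uC n m : (n <= m)%N -> rnorm (u m - u n) <= N1 / (1 - q) * q ^+ n.
  move=> nm; have : rnorm (u m - u n) <= N1 / (1 - q) * (q ^+ n - q ^+ m).
    elim: m nm => [|m IH]; first by rewrite leqn0 => /eqP->; rewrite !subrr rnorm0 mulr0.
    rewrite leq_eqVlt => /predU1P[->|]; first by rewrite !subrr rnorm0 mulr0.
    rewrite ltnS => /IH {}IH; rewrite /u big_ord_recr /= addrAC.
    apply: le_trans (ler_rnormD _ _) _.
    apply: le_trans (lerD IH (zn m)) _.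
    have -> : N1 / (1 - q) * (q ^+ n - q ^+ m.+1) =
        N1 / (1 - q) * (q ^+ n - q ^+ m) + N1 * q ^+ m.
      by rewrite exprS; field; rewrite gt_eqF.
    by [].
  move=> /le_trans; apply; rewrite ler_wpM2l ?divr_ge0 ?(ltW dq) //.
  by rewrite gerBl exprn_ge0.
have [y yu] := cauchy_geometric_cvg q01 uC.
have xu n : x * u n = 1 - z ^+ n.
  by rewrite -{1}[x](subKr 1) -/z -opprB mulNr -subrX1 opprB.
have ux n : u n * x = x * u n.
  rewrite /u mulr_sumr mulr_suml; apply: eq_bigr => k _.
  by apply/commr_sym/commrX; rewrite /z; apply: commrB; [exact: commr1|].
have eq0 (w : A) C : (forall n, rnorm w <= C * q ^+ n) -> w = 0.
  move=> /(geometric_le0 q01) w0; apply/eqP; rewrite -rnorm_eq0.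
  by rewrite eq_le w0 rnorm_ge0.
exists y; split; apply/eqP; rewrite -subr_eq0; apply/eqP;
  apply: (eq0 _ (rnorm x * (N1 / (1 - q)) + N1)) => n.
- have -> : x * y - 1 = x * (y - u n) - z ^+ n.
    by rewrite mulrBr xu -addrA -opprD subrK.
  apply: le_trans (ler_rnormD _ _) _; rewrite rnormN [leRHS]mulrDl lerD //.
  by rewrite (le_trans (rnormM_le _ _)) // -mulrA ler_wpM2l ?rnorm_ge0.
- have -> : y * x - 1 = (y - u n) * x - z ^+ n.
    by rewrite mulrBl ux xu -addrA -opprD subrK.
  apply: le_trans (ler_rnormD _ _) _; rewrite rnormN [leRHS]mulrDl lerD //.
  rewrite (le_trans (rnormM_le _ _)) // mulrC -mulrA ler_wpM2l ?rnorm_ge0 //.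
Qed.
End completeness.

(** * The bicommutant of two commuting elements *)

Section bicommutant.
Context {R : realType} {A : banachAlgType R[i]}.
Variables x y : A.

(* When [x] and [y] commute this is the bicommutant of [{x, y}]; commutation
   with [x] and [y] is required so that it is always commutative. *)
Definition bicommutant : {pred A} :=
  [pred z | `[< [/\ GRing.comm z x, GRing.comm z y &
    forall w : A, GRing.comm w x -> GRing.comm w y -> GRing.comm w z] >]].

Lemma bicommutantP z :
  reflect [/\ GRing.comm z x, GRing.comm z y &
    forall w : A, GRing.comm w x -> GRing.comm w y -> GRing.comm w z]
    (z \in bicommutant).
Proof. exact: asboolP. Qed.

Lemma commrZ (c : R[i]) (u w : A) : GRing.comm w u -> GRing.comm w (c *: u).
Proof. by rewrite /GRing.comm -scalerAl -scalerAr => ->. Qed.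

Lemma bicommutant_subalg_closed : subalg_closed bicommutant.
Proof.
split=> [|c u v /bicommutantP[ux uy uP] /bicommutantP[vx vy vP]
          |u v /bicommutantP[ux uy uP] /bicommutantP[vx vy vP]];
  apply/bicommutantP; split=> [||w wx wy].
- exact: commr_sym (commr1 _).
- exact: commr_sym (commr1 _).
- exact: commr1.
- by apply/commr_sym/commrD; [apply: commrZ|]; apply: commr_sym.
- by apply/commr_sym/commrD; [apply: commrZ|]; apply: commr_sym.
- by apply: commrD; [apply: commrZ; exact: uP|exact: vP].
- by apply/commr_sym/commrM; apply: commr_sym.
- by apply/commr_sym/commrM; apply: commr_sym.
- by apply: commrM; [exact: uP|exact: vP].
Qed.

HB.instance Definition _ :=
  GRing.isSubalgClosed.Build R[i] A bicommutant bicommutant_subalg_closed.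

Record bicommutant_of := Bicommutant
  { bicommutant_val :> A ; bicommutant_mem : bicommutant_val \in bicommutant }.

HB.instance Definition _ := [isSub for bicommutant_val].
HB.instance Definition _ := [Choice of bicommutant_of by <:].
HB.instance Definition _ := [SubChoice_isSubAlgebra of bicommutant_of by <:].

Lemma bicommutant_mulC : commutative (@GRing.mul bicommutant_of).
Proof.
move=> u v; apply: val_inj; rewrite !GRing.valM.
have /bicommutantP[ux uy _] := bicommutant_mem u.
have /bicommutantP[_ _ vP] := bicommutant_mem v.
exact: vP.
Qed.

HB.instance Definition _ :=
  GRing.PzRing_hasCommutativeMul.Build bicommutant_of bicommutant_mulC.

Let p (z : bicommutant_of) : R := rnorm (\val z).

Let psn : seminorm p.
Proof.
split=> [u v|c u]; rewrite /p; first by rewrite raddfD ler_rnormD.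
by rewrite linearZ rnormZ.
Qed.

Let pM (u v : bicommutant_of) : p (u * v) <= p u * p v.
Proof. by rewrite /p rmorphM rnormM_le. Qed.

(** An inverse commutes with all that its element commutes with. Thus invertibility in [A] can be
    used inside the commutative subalgebra. *)
Lemma bicommutant_inv (z w : A) :
  z \in bicommutant -> z * w = 1 -> w * z = 1 -> w \in bicommutant.
Proof.
move=> /bicommutantP[zx zy zP] zw wz.
have cinv v : GRing.comm v z -> GRing.comm v w.
  rewrite /GRing.comm => vz.
  by rewrite -[RHS]mulr1 -zw mulrA -(mulrA w) vz mulrA wz mul1r.
apply/bicommutantP; split=> [||v vx vy].
- by apply/commr_sym/cinv/commr_sym.
- by apply/commr_sym/cinv/commr_sym.
- by apply: cinv; exact: zP.
Qed.

Let p_inv (z : bicommutant_of) : p (1 - z) < 1 -> exists w, z * w = 1.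
Proof.
rewrite /p rmorphB rmorph1 => /invertible_near1[w [zw wz]].
exists (Bicommutant (bicommutant_inv (bicommutant_mem z) zw wz)).
by apply: val_inj; rewrite rmorphM rmorph1.
Qed.

Lemma bicommutant_drazin (z : A) d m :
    z \in bicommutant ->
    z ^+ m = z ^+ m.+1 * d -> GRing.comm z d -> d * z * d = d ->
  d \in bicommutant.
Proof.
move=> /bicommutantP[zx zy zP] dm dz dzd.
have cd v : GRing.comm z v -> GRing.comm d v by exact: drazin_inverse_bicomm dm dz dzd.
apply/bicommutantP; split=> [||v vx vy]; [exact: cd|exact: cd|].
by apply/commr_sym/cd/commr_sym; exact: zP.
Qed.

(** The bicommutant contains the inverses and Drazin inverses of its elements, so the hypothesis
    gives the three cases of [strongly_pi_regular_mul] there. The equation obtained is read back in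
    [A], with a coefficient that commutes with [x * y - l%:A]. *)
Theorem drazin_invertible_mul (l : R[i]) : GRing.comm x y ->
    (forall mu nu : R[i], mu * nu = l -> spectrum x mu -> spectrum y nu ->
       drazin_invertible (x - mu%:A) /\ drazin_invertible (y - nu%:A)) ->
  drazin_invertible (x * y - l%:A).
Proof.
move=> xy H.
have xB : x \in bicommutant by apply/bicommutantP; split=> // w ->.
have yB : y \in bicommutant.
  by apply/bicommutantP; split=> //; exact: commr_sym.
pose xb := Bicommutant xB; pose yb := Bicommutant yB.
have valM (u v : bicommutant_of) : \val (u * v) = \val u * \val v by [].
have valX (u : bicommutant_of) n : \val (u ^+ n) = \val u ^+ n by rewrite rmorphXn.
have valA (u : bicommutant_of) (c : R[i]) : \val (u - c%:A) = \val u - c%:A by [].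
have unitB (u : bicommutant_of) (c : R[i]) : ~ spectrum (\val u) c ->
    exists v : bicommutant_of, (u - c%:A) * v = 1.
  move=> /negP; rewrite negbK => uc.
  have ucB : \val u - c%:A \in bicommutant by rewrite -valA; exact: bicommutant_mem.
  exists (Bicommutant (bicommutant_inv ucB (mulrV uc) (mulVr uc))).
  by apply: val_inj; rewrite valM valA mulrV.
have drazinB (u : bicommutant_of) (c : R[i]) :
    drazin_invertible (\val u - c%:A) ->
    exists (d : bicommutant_of) m, (u - c%:A) ^+ m = (u - c%:A) ^+ m.+1 * d.
  move=> /drazin_invertibleP[d [m [dm dc dcd]]].
  have ucB : \val u - c%:A \in bicommutant by rewrite -valA; exact: bicommutant_mem.
  exists (Bicommutant (bicommutant_drazin ucB dm dc dcd)), m.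
  by apply: val_inj; rewrite valM !valX valA dm.
have [|m [u mu]] := @strongly_pi_regular_mul _ _ _ psn pM p_inv xb yb l.
  move=> mu nu E.
  have [xmu|/(unitB xb)] := pselect (spectrum x mu); last by constructor 1.
  have [ynu|/(unitB yb)] := pselect (spectrum y nu); last by constructor 2.
  have [/(drazinB xb) ? /(drazinB yb) ?] := H mu nu E xmu ynu.
  by constructor 3.
apply: (@drazin_invertible_comm _ _ _ (\val u) m).
  by have := congr1 val mu; rewrite valM !valX valA.
have : (xb * yb - l%:A) * u = u * (xb * yb - l%:A) by rewrite mulrC.
by move/(congr1 val); rewrite !valM valA.
Qed.

End bicommutant.
(** * Poles of the resolvent *)

Section laurent.
Context {R : realType}.

Lemma le0_small (a C d : R) : 0 < d ->
  (forall t, 0 < t < d -> a <= C * t) -> a <= 0.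
Proof.
move=> d0 aC; apply/ler_addgt0Pr => e e0; rewrite add0r.
have C1 : 0 < `|C| + 1 by rewrite ltr_wpDl.
pose t := Num.min (d / 2) (e / (`|C| + 1)).
have t0 : 0 < t by rewrite lt_min !divr_gt0.
have td : t < d by rewrite gt_min ltr_pdivrMr // ltr_pMr // ltr1n.
have tC : t * (`|C| + 1) <= e by rewrite -ler_pdivlMr // ge_min lexx orbT.
have := aC t; rewrite t0 td => /(_ isT).
have : C * t <= `|C| * t by rewrite ler_wpM2r ?ler_norm // ltW.
nra.
Qed.

Lemma ler_rnorm_sum (V : normedModType R[i]) n (u : 'I_n -> V) :
  rnorm (\sum_(k < n) u k) <= \sum_(k < n) rnorm (u k).
Proof.
elim: n u => [|n IH] u; first by rewrite !big_ord0 rnorm0.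
rewrite !big_ord_recl (le_trans (ler_rnormD _ _)) // lerD2l; exact: IH.
Qed.

(** As [z] tends to 0 the constant coefficient is seen to vanish; division by [z] then lowers
    [p]. *)
Lemma poly_small_eq0 (V : normedModType R[i]) (a : nat -> V) p (C d : R) :
    0 < d ->
    (forall z : R[i], 0 < rnorm z < d ->
       rnorm (\sum_(n < p) z ^+ n *: a n) <= C * rnorm z ^+ p) ->
  forall n, (n < p)%N -> a n = 0.
Proof.
move=> d0; elim: p a => [//|p IH] a aC.
have zt t : 0 < t -> rnorm (t%:C : R[i]) = t by move=> t0; rewrite rnorm_realc gtr0_norm.
have a0 : a 0%N = 0.
  pose S := \sum_(k < p) rnorm (a k.+1).
  apply/eqP; rewrite -rnorm_eq0 eq_le rnorm_ge0 andbT.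
  pose d1 := Num.min d 1; have d10 : 0 < d1 by rewrite lt_min d0 ltr01.
  apply: (@le0_small _ (`|C| + S) d1) => // t /andP[t0].
  rewrite lt_min => /andP[td t1].
  have := aC t%:C; rewrite zt // t0 td => /(_ isT).
  rewrite big_ord_recl expr0 scale1r; set s := \sum_(k < p) _.
  have sS : rnorm s <= S * t.
    apply: le_trans (ler_rnorm_sum _) _; rewrite mulr_suml; apply: ler_sum => k _.
    rewrite rnormZ rnormXc zt // mulrC ler_wpM2l ?rnorm_ge0 //= exprS.
    by rewrite ler_piMr ?exprn_ile1 // ltW.
  have tp : C * t ^+ p.+1 <= `|C| * t.
    apply: (@le_trans _ _ (`|C| * t ^+ p.+1)).
      by rewrite ler_wpM2r ?ler_norm // exprn_ge0 // ltW.
    by rewrite ler_wpM2l // exprS ler_piMr ?exprn_ile1 // ltW.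
  have := ler_rnormD (a 0%N + s) (- s); rewrite addrK rnormN => ? ?.
  by rewrite mulrDl; lra.
have aS : forall n, (n < p)%N -> a n.+1 = 0.
  apply: IH => z /[dup] zd /andP[z0 _]; have := aC z zd.
  rewrite big_ord_recl a0 scaler0 add0r.
  under eq_bigr do rewrite /= exprS -scalerA.
  by rewrite -scaler_sumr rnormZ exprS mulrCA ler_pM2l.
by case=> [//|n]; rewrite ltnS; exact: aS.
Qed.

Lemma rnorm_cvg (V : normedModType R[i]) (u : nat -> V) (l : V) (e : R) :
  u @ \oo --> l -> 0 < e -> exists N, forall n, (N <= n)%N -> rnorm (l - u n) < e.
Proof.
move=> ul e0; have e0' : 0 < e%:C by rewrite ltcR.
have /cvgrPdist_lt/(_ _ e0')[N _ HN] := ul.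
by exists N => n /HN /=; rewrite rnorm_lt_iff.
Qed.

(** Convergence at a single point [t] bounds [t ^+ n * rnorm (c n)]; for [rnorm z < t / 2] the terms
    of positive index are then dominated by a geometric series of ratio [q <= 1 / 2]. *)
Lemma power_series_near0 (V : normedModType R[i]) (c : nat -> V) (s : R[i] -> V) (d : R) :
    0 < d ->
    (forall z : R[i], 0 < rnorm z < d ->
       series (fun n => z ^+ n *: c n) @ \oo --> s z) ->
  exists C d', 0 < d' /\ forall z : R[i], 0 < rnorm z < d' ->
    rnorm (s z - c 0%N) <= C * rnorm z.
Proof.
move=> d0 cvs; pose t := d / 2.
have t0 : 0 < t by rewrite divr_gt0.
have td : t < d by rewrite ltr_pdivrMr // ltr_pMr // ltr1n.
have [M M0 cM] : exists2 M, 0 <= M & forall n, t ^+ n * rnorm (c n) <= M.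
  have ttd : 0 < rnorm (t%:C : R[i]) < d by rewrite rnorm_realc gtr0_norm ?t0.
  have [N HN] := rnorm_cvg (cvs _ ttd) ltr01.
  have tE n : t ^+ n * rnorm (c n) = rnorm (t%:C ^+ n *: c n).
    by rewrite rnormZ rnormXc rnorm_realc gtr0_norm.
  (* A term of index at least [N] is a difference of two partial sums within 1 of the limit, whence
     the 2. *)
  exists (2 + \sum_(k < N) t ^+ k * rnorm (c k)).
    by rewrite addr_ge0 ?sumr_ge0 // => k _; rewrite mulr_ge0 ?rnorm_ge0 ?exprn_ge0 ?ltW.
  have s0 : 0 <= \sum_(k < N) t ^+ k * rnorm (c k).
    by rewrite sumr_ge0 // => k _; rewrite mulr_ge0 ?rnorm_ge0 ?exprn_ge0 ?ltW.
  move=> n; have [nN|Nn] := ltnP n N.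
    rewrite (bigD1 (Ordinal nN)) //= addrA addrAC ler_wpDl // addr_ge0 //.
    by rewrite sumr_ge0 // => k _; rewrite mulr_ge0 ?rnorm_ge0 ?exprn_ge0 ?ltW.
  have h1 := HN n Nn; have h2 := HN n.+1 (leqW Nn).
  set S := series _ in h1 h2.
  have : t ^+ n * rnorm (c n) <= rnorm (S n.+1 - s t%:C) + rnorm (s t%:C - S n).
    rewrite tE (_ : _ *: c n = S n.+1 - S n); first exact: ler_rnormB_trans.
    by rewrite /S /series /= big_nat_recr //= addrAC subrr add0r.
  rewrite rnormB; lra.
exists (2 * M / t), (t / 2); split; first by rewrite divr_gt0.
move=> z /andP[z0 zt]; pose q := rnorm z / t.
have q0 : 0 <= q by rewrite divr_ge0 ?rnorm_ge0 ?ltW.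
have q2 : q <= 1 / 2 by rewrite ler_pdivrMr //; lra.
have zd : 0 < rnorm z < d by rewrite z0 /=; lra.
have -> : 2 * M / t * rnorm z = 2 * M * q by rewrite /q; ring.
have part n : rnorm (series (fun n => z ^+ n *: c n) n.+1 - c 0%N) <=
    2 * M * q * (1 - q ^+ n).
  elim: n => [|n IH].
    by rewrite /series /= big_nat1 expr0 scale1r !subrr rnorm0 mulr0.
  rewrite /series /= big_nat_recr //= addrAC; apply: le_trans (ler_rnormD _ _) _.
  apply: le_trans (lerD IH (_ : _ <= M * q ^+ n.+1)) _.
    rewrite rnormZ rnormXc expr_div_n mulrA ler_pdivlMr ?exprn_gt0 //.
    have := cM n.+1; have := exprn_ge0 n.+1 (ltW z0); nra.
  rewrite !exprS; have := exprn_ge0 n q0; set r := q ^+ n => r0.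
  have qr : 0 <= M * (q * r) by do 2 apply: mulr_ge0 => //.
  have : 0 <= M * (q * r) * (1 - 2 * q) by apply: mulr_ge0 => //; lra.
  lra.
apply/ler_addgt0Pr => e e0; have [N HN] := rnorm_cvg (cvs z zd) e0.
have := ler_rnormB_trans (series (fun n => z ^+ n *: c n) N.+1) (s z) (c 0%N).
have := HN N.+1 (leqnSn _); have := part N.
have : 0 <= 2 * M * q * q ^+ N.
  by do 2 (apply: mulr_ge0; last by rewrite ?exprn_ge0); rewrite mulr_ge0.
lra.
Qed.

Lemma punctured_nearP (K : numFieldType) (l0 : K) (P : K -> Prop) :
  (\forall l \near l0^', P l) ->
  exists2 d : K, 0 < d & forall z, 0 < `|z| < d -> P (l0 + z).
Proof.
rewrite /dnbhs near_withinE => /nbhs_ballP[d /= d0 dP].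
exists d => // z /andP[z0 zd]; apply: dP.
  by rewrite -ball_normE /ball_ /= opprD addNKr normrN.
by rewrite -subr_eq0 addrAC subrr add0r -normr_gt0.
Qed.

Lemma finite_series_lim (V : normedModType R[i]) (u : nat -> V) (t : V) p :
    (forall n, (p <= n)%N -> u n = 0) -> series u @ \oo --> t ->
  t = \sum_(n < p) u n.
Proof.
move=> u0 ut; apply/eqP; rewrite -subr_eq0 -rnorm_eq0 eq_le rnorm_ge0 andbT.
apply/ler_addgt0Pr => e e0; rewrite add0r.
have [N HN] := rnorm_cvg ut e0.
have := HN (maxn p N) (leq_maxr _ _).
rewrite /series /= (big_cat_nat (leq0n p) (leq_maxl p N)) /=.
have -> : \sum_(p <= i < maxn p N) u i = 0.
  by rewrite big_nat_cond big1 // => k /andP[/andP[pk _] _]; exact: u0.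
by rewrite addr0 big_mkord => /ltW.
Qed.

(** With [a := x - l0%:A], the coefficients in [(z%:A - a) * r z = 1] give [b 1 = a * c 0 + 1] and
    [a ^+ p * b 1 = 0]. Hence [a ^+ p = a ^+ p.+1 * (- c 0)], where [c 0] commutes with [a]. *)
Lemma pole_drazin_invertible (A : banachAlgType R[i]) (x : A) (l0 : R[i]) :
  poles x l0 -> drazin_invertible (x - l0%:A).
Proof.
move=> [_ [c [b [/punctured_nearP[dC dC0 lauC] [p [p1 _ b0]]]]]].
have dE : dC = (complex.Re dC)%:C by rewrite RRe_real // gtr0_real.
set d := complex.Re dC in dE.
have d0 : 0 < d by rewrite -ltcR -dE.
have lau (z : R[i]) : 0 < rnorm z < d -> 0 < `|z| < dC.
  by rewrite dE rnorm_lt_iff normr_gt0 -rnorm_eq0 lt_def rnorm_ge0 andbT.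
set a := x - l0%:A.
pose r (z : R[i]) := resolvent (l0 + z) x.
have rP (z : R[i]) : 0 < rnorm z < d -> (z%:A - a) * r z = 1 /\ r z * (z%:A - a) = 1.
  move=> /lau/lauC[/negP]; rewrite negbK -unitrN opprB => u _.
  have -> : z%:A - a = (l0 + z)%:A - x by rewrite /a scalerDl opprB addrCA addrA.
  by rewrite /r /resolvent divrr // mulVr.
clearbody a.
have /choice[s sP] (z : R[i]) : exists s : A, 0 < rnorm z < d ->
    series (fun n => z ^+ n *: c n) @ \oo --> s /\
    r z = s + \sum_(n < p) z ^- n.+1 *: b n.+1.
  have [zd|zd] := pselect (0 < rnorm z < d); last by exists 0 => /zd.
  have [_ [s [t [sc tc rE]]]] := lauC _ (lau z zd); exists s => _; rewrite /r rE; split.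
    by move: sc; under eq_fun do rewrite addrAC subrr add0r.
  congr (_ + _); move: tc; under eq_fun do rewrite addrAC subrr add0r.
  by apply: finite_series_lim => n pn; rewrite b0 ?scaler0.
have [C [e [e0 sC]]] := power_series_near0 d0 (fun z zd => (sP z zd).1).
(* [g] lists the coefficients of [z ^+ p *: r z] up to order [p]. *)
pose g j := if (j < p)%N then b (p - j)%N else c 0%N.
have main (z : R[i]) : 0 < rnorm z < Num.min d e ->
    rnorm (\sum_(j < p.+1) z ^+ j *: g j - z ^+ p *: r z) <= C * rnorm z ^+ p.+1.
  move=> /andP[z0]; rewrite lt_min => /andP[zd ze].
  have z_neq0 : z != 0 by rewrite -rnorm_eq0 gt_eqF.
  have zrd : 0 < rnorm z < d by rewrite z0.
  have zre : 0 < rnorm z < e by rewrite z0.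
  rewrite (sP z zrd).2 big_ord_recr /= /g ltnn scalerDr scaler_sumr.
  have -> : \sum_(i < p) z ^+ i *: (if (i < p)%N then b (p - i)%N else c 0%N) =
      \sum_(n < p) z ^+ p *: (z ^- n.+1 *: b n.+1).
    rewrite (reindex_inj rev_ord_inj) /=; apply: eq_bigr => i _.
    have ip : (p - (p - i.+1) = i.+1)%N by rewrite subKn.
    rewrite ip ifT; last by rewrite ltn_subrL.
    rewrite scalerA; congr (_ *: _); apply: (mulIf (expf_neq0 i.+1 z_neq0)).
    by rewrite mulfVK ?expf_neq0 // -exprD subnK.
  rewrite -scaler_sumr [X in _ - X]addrC opprD addrACA subrr add0r -scalerBr.
  rewrite rnormZ rnormXc rnormB exprSr mulrCA.
  by rewrite ler_wpM2l ?exprn_ge0 ?rnorm_ge0 //; exact: sC.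
have de0 : 0 < Num.min d e by rewrite lt_min d0.
pose D z := \sum_(j < p.+1) z ^+ j *: g j.
(* As [r z] commutes with [a], the commutator of [D z] and [a] is of order [p.+1] in [z]; being a
   polynomial of degree at most [p], it is zero. *)
have gC j : (j <= p)%N -> GRing.comm (g j) a.
  rewrite -ltnS => jp; apply/eqP; rewrite -subr_eq0; apply/eqP.
  move: j jp; apply: (@poly_small_eq0 _ _ _ (2 * (rnorm a * C)) _ de0) => z zde.
  have := zde; rewrite lt_min andbA => /andP[zd _].
  have ra : r z * a = a * r z.
    have [h1 h2] := rP z zd.
    have : r z * (z%:A - a) = (z%:A - a) * r z by rewrite h1.
    by rewrite mulrBr mulrBl -scalerAr -scalerAl mulr1 mul1r => /addrI/oppr_inj.
  have -> : \sum_(n < p.+1) z ^+ n *: (g n * a - a * g n) =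
      (D z - z ^+ p *: r z) * a - a * (D z - z ^+ p *: r z).
    rewrite mulrBl mulrBr -scalerAl -scalerAr ra opprB addrA subrK.
    rewrite mulr_suml mulr_sumr -sumrB; apply: eq_bigr => j _.
    by rewrite scalerBr -scalerAl -scalerAr.
  apply: le_trans (ler_rnormD _ _) _; rewrite rnormN.
  have := rnormM_le (D z - z ^+ p *: r z) a.
  have := rnormM_le a (D z - z ^+ p *: r z).
  have : rnorm a * rnorm (D z - z ^+ p *: r z) <= rnorm a * (C * rnorm z ^+ p.+1).
    by rewrite ler_wpM2l ?rnorm_ge0 //; exact: main.
  by rewrite mulrC => ? ? ?; lra.
(* These are the coefficients of [(z%:A - a) * D z - z ^+ p *: 1] up to order [p]; the remaining
   term [z ^+ p.+1 *: c 0] goes into the error. *)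
pose h j := (if j is j'.+1 then g j' else 0) - a * g j - (if j == p then 1 else 0).
have h0 j : (j < p.+1)%N -> h j = 0.
  pose N1 := rnorm (1 : A).
  move: j; apply: (@poly_small_eq0 _ _ _ ((d * N1 + rnorm a) * C + rnorm (c 0%N)) _ de0).
  move=> z zde; have := zde; rewrite lt_min andbA => /andP[zd _].
  have /andP[z0 zd'] := zd.
  have -> : \sum_(n < p.+1) z ^+ n *: h n =
      (z%:A - a) * (D z - z ^+ p *: r z) - z ^+ p.+1 *: c 0%N.
    have -> : \sum_(n < p.+1) z ^+ n *: h n =
        \sum_(n < p.+1) z ^+ n *: (if n : nat is j'.+1 then g j' else 0) -
        a * D z - z ^+ p *: 1.
      have -> : z ^+ p *: 1 =
          \sum_(n < p.+1) z ^+ n *: (if n == p :> nat then 1 else 0 : A).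
        rewrite big_ord_recr /= eqxx big1 ?add0r // => n _.
        by rewrite ltn_eqF // scaler0.
      rewrite mulr_sumr -!sumrB; apply: eq_bigr => n _.
      by rewrite !scalerBr -scalerAr.
    rewrite big_ord_recl scaler0 add0r mulrBr -[in RHS]scalerAr (rP z zd).1.
    rewrite [in RHS]mulrBl -scalerAl mul1r /D big_ord_recr /= scalerDr scaler_sumr scalerA.
    have -> : g p = c 0%N by rewrite /g ltnn.
    rewrite -exprS.
    under eq_bigr do rewrite /= exprS -scalerA.
    set S := \sum_(i < p) _; set w := z ^+ p.+1 *: c 0%N.
    by rewrite [S + w]addrC -!(addrA w) [RHS]addrC subrK.
  apply: le_trans (ler_rnormD _ _) _; rewrite rnormN rnormZ rnormXc.
  have h1 : rnorm (z%:A - a) <= d * N1 + rnorm a.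
    apply: le_trans (ler_rnormD _ _) _; rewrite rnormN rnormZ lerD2r.
    by rewrite ler_wpM2r ?rnorm_ge0 // ltW.
  have h2 : rnorm ((z%:A - a) * (D z - z ^+ p *: r z)) <=
      (d * N1 + rnorm a) * (C * rnorm z ^+ p.+1).
    apply: le_trans (rnormM_le _ _) _.
    by apply: ler_pM => //; try exact: rnorm_ge0; exact: main.
  by rewrite [leRHS]mulrDl -mulrA [rnorm (c _) * _]mulrC lerD2r.
have gS j : (j.+1 <= p)%N -> g j = a * g j.+1 + (if j.+1 == p then 1 else 0).
  move=> jp; have := h0 j.+1; rewrite ltnS jp /h => /(_ isT)/eqP.
  by rewrite subr_eq0 subr_eq addrC => /eqP.
have ag j : (j < p)%N -> a ^+ j.+1 * g j = 0.
  elim: j => [|j IH] jp.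
    have := h0 0%N isT; rewrite /h expr1 sub0r.
    rewrite (_ : (0%N == p) = false); last by rewrite ltn_eqF.
    by rewrite subr0 => /eqP; rewrite oppr_eq0 => /eqP.
  have := gS j (ltnW jp); rewrite ltn_eqF // addr0 => E.
  by rewrite exprSr -mulrA -E IH // ltnW.
have := ag p.-1; have := gS p.-1; rewrite prednK // leqnn eqxx => /(_ isT) -> /(_ isT).
rewrite /g ltnn mulrDr mulr1 mulrA -exprSr => /eqP.
rewrite addrC addr_eq0 => /eqP E.
apply: (@drazin_invertible_comm _ _ _ (- c 0%N) p); first by rewrite mulrN.
apply: commrN; apply: commr_sym; have := gC p (leqnn p).
by rewrite /g ltnn.
Qed.
End laurent.
(** * The Hahn-Banach theorem *)

Section hahn_banach.
Context {R : realType} {V : lmodType R[i]}.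
Implicit Types (p q : V -> R) (x y v : V).

(** Homogeneity is stated as an inequality, which is convenient for infima; equality follows on
    using [t^-1]. *)
Definition sublinear q : Prop :=
  (forall x y, q (x + y) <= q x + q y) /\
  (forall (t : R) x, 0 < t -> q (t%:C *: x) <= t * q x).

Lemma sublinearZ q t x : sublinear q -> 0 < t -> q (t%:C *: x) = t * q x.
Proof.
move=> [_ qZ] t0; apply/eqP; rewrite eq_le qZ //=.
have := qZ t^-1 (t%:C *: x); rewrite invr_gt0 => /(_ t0).
rewrite scalerA -rmorphM mulVf ?gt_eqF // scale1r.
by rewrite -(ler_pM2l t0) mulrA divff ?gt_eqF // mul1r.
Qed.

Lemma sublinear0 q : sublinear q -> q 0 = 0.
Proof.
move=> qs; have := @sublinearZ q 2 0 qs (ltr0n _ 2).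
by rewrite scaler0 => ?; lra.
Qed.

Lemma sublinear_ge q x : sublinear q -> - q (- x) <= q x.
Proof.
by move=> qs; have := qs.1 x (- x); rewrite subrr sublinear0 // => ?; lra.
Qed.

Lemma inf_sublinear (F : V -> set R) :
    (forall x, F x !=set0) -> (forall x, has_lbound (F x)) ->
    (forall x y a b, F x a -> F y b -> exists2 c, F (x + y) c & c <= a + b) ->
    (forall t x a, 0 < t -> F x a -> exists2 c, F (t%:C *: x) c & c <= t * a) ->
  sublinear (fun x => inf (F x)).
Proof.
move=> F0 Flb FD FZ; have infF x : has_inf (F x) by split.
split=> [x y|t x t0].
  apply/ler_addgt0Pr => e e0; have e2 : 0 < e / 2 by rewrite divr_gt0.
  have [a Fa ax] := inf_adherent e2 (infF x).
  have [b Fb xb] := inf_adherent e2 (infF y).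
  have [c Fc cab] := FD _ _ _ _ Fa Fb.
  by have := ge_inf (Flb _) Fc; lra.
rewrite mulrC -ler_pdivrMr //; apply: lb_le_inf => // a Fa.
have [c Fc ca] := FZ _ _ _ t0 Fa; rewrite ler_pdivrMr // mulrC.
exact: le_trans (ge_inf (Flb _) Fc) ca.
Qed.

(** Taking [t = 0] shows that it lies below [q]; taking [t = 1] at [- v] bounds it there by
    [- q v]. *)
Definition directional q v x : R :=
  inf [set q (x + t%:C *: v) - t * q v | t in [set t : R | 0 <= t]].

Lemma directional_lb q v x : sublinear q ->
  lbound [set q (x + t%:C *: v) - t * q v | t in [set t : R | 0 <= t]] (- q (- x)).
Proof.
move=> qs _ [t /= t0 <-].
have -> : t * q v = q (t%:C *: v).
  move: t0; rewrite le_eqVlt => /predU1P[<-|t0]; last by rewrite sublinearZ.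
  by rewrite mul0r scale0r sublinear0.
have := qs.1 (x + t%:C *: v) (- x); rewrite addrC addKr; lra.
Qed.

Lemma directional_le q v x t : sublinear q -> 0 <= t ->
  directional q v x <= q (x + t%:C *: v) - t * q v.
Proof.
move=> qs t0; apply: ge_inf; last by exists t.
by exists (- q (- x)); exact: directional_lb.
Qed.

Lemma directional_sublinear q v : sublinear q -> sublinear (directional q v).
Proof.
move=> qs; apply: inf_sublinear.
- by move=> x; exists (q (x + 0%:C *: v) - 0 * q v), 0 => /=.
- by move=> x; exists (- q (- x)); exact: directional_lb.
- move=> x y _ _ [t /= t0 <-] [s /= s0 <-].
  exists (q (x + y + (t + s)%:C *: v) - (t + s) * q v).
    by exists (t + s) => //=; rewrite addr_ge0.
  have := qs.1 (x + t%:C *: v) (y + s%:C *: v).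
  by rewrite addrACA -scalerDl -rmorphD; lra.
- move=> s x _ s0 [t /= t0 <-].
  exists (q (s%:C *: x + (s * t)%:C *: v) - (s * t) * q v).
    by exists (s * t) => //=; rewrite mulr_ge0 // ltW.
  have := qs.2 s (x + t%:C *: v) s0.
  by rewrite scalerDr scalerA -rmorphM; lra.
Qed.

(** Zorn's lemma downwards: a nonempty chain has its pointwise infimum as lower bound. This infimum
    is finite because each member is at least [- p (- x)] at [x], and subadditive because the
    smaller of two members serves for both. *)
Lemma minimal_sublinear p : sublinear p ->
  exists q, [/\ sublinear q, forall x, q x <= p x &
    forall q', sublinear q' -> (forall x, q' x <= q x) -> forall x, q x <= q' x].
Proof.
move=> ps.
pose T := {q : V -> R | sublinear q /\ forall x, q x <= p x}.
pose below (q q' : T) := `[< forall x, sval q' x <= sval q x >].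
have t0 : T by exists p; split=> // x.
have [||C tot|[q [qs qp]] qmin] := @ZL_preorder T t0 below.
- by move=> q; apply/asboolP.
- move=> q q' q'' /asboolP qq' /asboolP qq''; apply/asboolP => x.
  exact: le_trans (qq'' x) (qq' x).
- have [[q0 Cq0]|C0] := pselect (C !=set0); last first.
    by exists t0 => q Cq; exfalso; apply: C0; exists q.
  pose F x := [set sval q x | q in C].
  have Flb x : has_lbound (F x).
    exists (- p (- x)) => _ [[q [qs qp]] _ <-] /=.
    by apply: le_trans (sublinear_ge x qs); rewrite lerN2.
  have rs : sublinear (fun x => inf (F x)).
    apply: inf_sublinear => //.
    - by move=> x; exists (sval q0 x), q0.
    - move=> x y _ _ [q Cq <-] [q' Cq' <-].
      have [/asboolP qq'|/asboolP qq'] := tot _ _ Cq Cq'.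
        exists (sval q' (x + y)); first by exists q'.
        by apply: le_trans ((proj1 (svalP q')).1 x y) _; rewrite lerD2r.
      exists (sval q (x + y)); first by exists q.
      by apply: le_trans ((proj1 (svalP q)).1 x y) _; rewrite lerD2l.
    - move=> t x _ t0' [q Cq <-]; exists (sval q (t%:C *: x)); first by exists q.
      exact: (proj1 (svalP q)).2.
  have rp x : inf (F x) <= p x.
    apply: le_trans (proj2 (svalP q0) x); apply: ge_inf => //.
    by exists q0.
  exists (exist _ (fun x => inf (F x)) (conj rs rp)) => q Cq.
  by apply/asboolP => x /=; apply: ge_inf => //; exists q.
exists q; split=> // q' q's q'q x.
have q'p y : q' y <= p y := le_trans (q'q y) (qp y).
have := qmin (exist _ q' (conj q's q'p)); move=> /(_ (asboolT q'q))/asboolP.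
exact.
Qed.

(* A minimal sublinear functional [q] is below [directional q y], hence
   superadditive; starting from [directional p v] forces the value at [v]. *)
Theorem hahn_banach_real p v : sublinear p ->
  exists f : V -> R,
    [/\ forall x y, f (x + y) = f x + f y,
        forall (t : R) x, f (t%:C *: x) = t * f x,
        forall x, f x <= p x & f v = p v].
Proof.
move=> ps; have [f [fs fp fmin]] := minimal_sublinear (directional_sublinear v ps).
have fle x : f x <= p x.
  apply: le_trans (fp x) _; have := @directional_le p v x 0 ps (lexx 0).
  by rewrite scale0r addr0 mul0r subr0.
have fD x y : f (x + y) = f x + f y.
  apply/eqP; rewrite eq_le fs.1 /= -lerBrDr.
  have ds := directional_sublinear y fs.
  have := fmin _ ds; move=> /(_ _ x)/le_trans; apply => [z|].
    have := @directional_le f y z 0 fs (lexx 0).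
    by rewrite scale0r addr0 mul0r subr0.
  have := @directional_le f y x 1 fs ler01.
  by rewrite scale1r mul1r.
have fN x : f (- x) = - f x.
  by have := fD x (- x); rewrite subrr sublinear0 // => ?; lra.
exists f; split=> //.
- move=> t x; have [t0|t0|->] := ltrgt0P t; first exact: sublinearZ.
    rewrite -[t]opprK rmorphN scaleNr fN sublinearZ ?oppr_gt0 //.
    by rewrite !mulNr.
  by rewrite mul0r scale0r sublinear0.
- apply/eqP; rewrite eq_le fle /=.
  have := fp (- v); have := @directional_le p v (- v) 1 ps ler01.
  by rewrite scale1r mul1r addNr sublinear0 // fN; lra.
Qed.

(** The real functional [f] is the real part of [f x - i f (i x)], which is complex linear. Rotating
    [x] by a unit scalar makes its value real and nonnegative, which carries the bound over to the
    modulus. *)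
Theorem hahn_banach p v : seminorm p ->
  exists phi : V -> R[i],
    [/\ forall (c : R[i]) x y, phi (c *: x + y) = c * phi x + phi y,
        forall x, rnorm (phi x) <= p x & p v <= rnorm (phi v)].
Proof.
move=> psn.
have ps : sublinear p.
  split=> [x y|t x t0]; first exact: seminormD.
  by rewrite seminormZ // rnorm_realc gtr0_norm.
have [f [fD fZ fp fv]] := hahn_banach_real v ps.
have fN x : f (- x) = - f x.
  by have := fZ (-1) x; rewrite rmorphN1 scaleN1r mulN1r.
pose phi x : R[i] := f x +i* - f ('i%C *: x).
have phiP c x y : phi (c *: x + y) = c * phi x + phi y.
  have fC (z : V) : f (c *: z) =
      complex.Re c * f z + complex.Im c * f ('i%C *: z).
    by rewrite {1}[c]complexE scalerDl mulrC -scalerA fD !fZ.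
  have fiC (z : V) : f ('i%C *: (c *: z)) =
      complex.Re c * f ('i%C *: z) - complex.Im c * f z.
    rewrite scalerA mulrC -scalerA fC scalerA -expr2 sqr_i scaleN1r fN.
    by rewrite mulrN.
  rewrite /phi scalerDr !fD fC fiC {fC fiC}; case: c => a b /=.
  by apply/eqP; rewrite eq_complex /=; apply/andP; split; apply/eqP; ring.
exists phi; split=> // [x|].
  have [->|w0] := eqVneq (phi x) 0; first by rewrite rnorm0 seminorm_ge0.
  have r0 : rnorm (phi x) != 0 by rewrite rnorm_eq0.
  pose c := (rnorm (phi x))%:C / phi x.
  have c1 : rnorm c = 1.
    apply: (mulIf r0); rewrite -rnormMc /c mulfVK // rnorm_realc mul1r.
    by rewrite ger0_norm ?rnorm_ge0.
  have : phi (c *: x) = (rnorm (phi x))%:C.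
    have phi0 : phi 0 = 0.
      apply: (addrI (phi 0)); have := phiP 1 0 0.
      by rewrite scale1r mul1r !addr0 => {1}<-.
    by have := phiP c x 0; rewrite phi0 !addr0 => ->; rewrite /c mulfVK.
  move=> /(congr1 (@complex.Re R)) /= <-.
  by apply: le_trans (fp _) _; rewrite seminormZ // c1 mul1r.
rewrite -fv; apply: le_trans (ler_Re_rnorm (phi v)).
exact: ler_norm.
Qed.

End hahn_banach.
(** * Slice maps *)

Section linear_packing.
Context {K : numFieldType}.

Lemma exists_linear (U V : lmodType K) (f : U -> V) :
  linear f -> exists g : {linear U -> V}, g =1 f.
Proof.
move=> fl; pose g : {linear U -> V} := HB.pack f (GRing.isLinear.Build K U V *:%R f fl).
by exists g.
Qed.

Lemma exists_bilinear (U V W : lmodType K) (f : U -> V -> W) :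
    (forall y, linear (f^~ y)) -> (forall x, linear (f x)) ->
  exists g : {bilinear U -> V -> W}, forall x y, g x y = f x y.
Proof.
move=> fl fr; pose fb : bilinear_for *:%R *:%R f := (fl, fr).
pose g : {bilinear U -> V -> W} :=
  HB.pack f (bilinear_isBilinear.Build K U V W *:%R *:%R f fb).
by exists g.
Qed.

End linear_packing.
Section completion.
Context {R : realType} {T : normedModType R[i]} {C : completeNormedModType R[i]}.
Variables (iota : {linear T -> C}) (iotaP : is_completion iota).

Let rnorm_iota t : rnorm (iota t) = rnorm t.
Proof. by rewrite /rnorm iotaP.1. Qed.

Lemma completion_approx (z : C) (e : R) : 0 < e -> exists t, rnorm (z - iota t) < e.
Proof.
move=> e0; have e0' : 0 < e%:C by rewrite ltcR.
have [||s [zs [t _ ts]]] := iotaP.2 (ball z e%:C).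
- by exists z; exact: ballxx.
- exact: ball_open.
by exists t; move: zs; rewrite -ts -ball_normE /ball_ /= rnorm_lt_iff.
Qed.

Lemma small_eq0 (V : normedModType R[i]) (v : V) (M : R) :
  (forall e, 0 < e -> rnorm v <= M * e) -> v = 0.
Proof.
move=> vM; apply/eqP; rewrite -rnorm_eq0 eq_le rnorm_ge0 andbT.
by apply: (@le0_small _ _ M 1) => // t /andP[t0 _]; exact: vM.
Qed.

(** The value [F z] is a limit along approximations of [z], recorded by [rnorm (F z - f t) <= M *
    rnorm (z - iota t)] for all [t]. Linearity, the bound (at [t = 0]) and the values on [iota t]
    all follow from this inequality. *)
Lemma completion_extend (V : completeNormedModType R[i]) (f : T -> V) (M : R) :
    linear f -> 0 <= M -> (forall t, rnorm (f t) <= M * rnorm t) ->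
  exists F : C -> V, [/\ linear F, forall z, rnorm (F z) <= M * rnorm z &
    forall t, F (iota t) = f t].
Proof.
move=> fl M0 fM.
have fB s t : f s - f t = f (s - t).
  by have [g gE] := exists_linear fl; rewrite -!gE raddfB.
have fI s t : rnorm (f s - f t) <= M * rnorm (iota s - iota t).
  by rewrite fB -raddfB rnorm_iota.
have ex z : exists l, forall t, rnorm (l - f t) <= M * rnorm (z - iota t).
  have /choice[t tz] n : exists t, rnorm (z - iota t) < (1 / 2) ^+ n.
    by apply: completion_approx; rewrite exprn_gt0.
  have h01 : 0 <= (1 / 2 : R) < 1 by apply/andP; split; lra.
  have [n m nm|l lt] := @cauchy_geometric_cvg _ V (f \o t) (2 * M) _ h01.
    apply: le_trans (fI _ _) _; rewrite -mulrA mulrCA ler_wpM2l //.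
    apply: le_trans (ler_rnormB_trans z _ _) _; rewrite rnormB.
    have := tz n; have := tz m.
    have : (1 / 2) ^+ m <= (1 / 2 : R) ^+ n by rewrite ler_wiXn2l //; lra.
    lra.
  exists l => s; rewrite -subr_le0; apply: (@geometric_le0 _ _ (3 * M) _ h01) => n.
  have := ler_rnormB_trans (f (t n)) l (f s); have := lt n => /=.
  have := fI (t n) s.
  have : M * rnorm (iota (t n) - iota s) <= M * ((1 / 2) ^+ n + rnorm (z - iota s)).
    rewrite ler_wpM2l //; apply: le_trans (ler_rnormB_trans z _ _) _.
    by rewrite rnormB lerD2r ltW.
  by rewrite mulrDr; lra.
have {ex} /choice[F FP] := ex.
exists F; split=> [c z w|z|t].
- apply/eqP; rewrite -subr_eq0; apply/eqP.
  apply: (@small_eq0 _ _ (2 * M * (rnorm c + 1))) => e e0.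
  have [t tz] := completion_approx z e0; have [s sw] := completion_approx w e0.
  have -> : F (c *: z + w) - (c *: F z + F w) =
      (F (c *: z + w) - f (c *: t + s)) - (c *: (F z - f t) + (F w - f s)).
    by rewrite fl scalerBr addrACA -opprD opprB addrA subrK.
  have h1 := FP (c *: z + w) (c *: t + s).
  have h2 : rnorm (c *: z + w - iota (c *: t + s)) <= rnorm c * e + e.
    rewrite linearP opprD addrACA -scalerBr; apply: le_trans (ler_rnormD _ _) _.
    by rewrite rnormZ lerD ?(ltW sw) // ler_wpM2l ?rnorm_ge0 ?ltW.
  have h3 : M * rnorm (c *: z + w - iota (c *: t + s)) <= M * (rnorm c * e + e).
    by rewrite ler_wpM2l.
  have h4 : rnorm (c *: (F z - f t)) <= rnorm c * (M * e).
    rewrite rnormZ ler_wpM2l ?rnorm_ge0 // (le_trans (FP _ _)) //.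
    by rewrite ler_wpM2l // ltW.
  have h5 : rnorm (F w - f s) <= M * e.
    by rewrite (le_trans (FP _ _)) // ler_wpM2l // ltW.
  have := ler_rnormD (F (c *: z + w) - f (c *: t + s))
    (- (c *: (F z - f t) + (F w - f s))).
  have := ler_rnormD (c *: (F z - f t)) (F w - f s).
  rewrite rnormN.
  have -> : 2 * M * (rnorm c + 1) * e =
    M * (rnorm c * e + e) + (rnorm c * (M * e) + M * e) by ring.
  lra.
- have f0 : f 0 = 0 by have [g gE] := exists_linear fl; rewrite -gE linear0.
  by have := FP z 0; rewrite f0 (linear0 iota) !subr0.
- apply/eqP; rewrite -subr_eq0 -rnorm_eq0 eq_le rnorm_ge0 andbT.
  by have := FP (iota t) t; rewrite subrr rnorm0 mulr0.
Qed.

End completion.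

Section slice.
Context {R : realType} {A B AB : banachAlgType R[i]}.
Context {T : normedModType R[i]} {tens : {bilinear A -> B -> T}}.
Context {iota : {linear T -> AB}}.
Hypothesis H : is_banach_tensor tens iota.

Lemma tensor_linear_eq0 (V : lmodType R[i]) (f : T -> V) :
  linear f -> (forall x y, f (tens x y) = 0) -> forall t, f t = 0.
Proof.
move=> fl f0 t; have [g gE] := exists_linear fl.
have lin0 (U : lmodType R[i]) : linear ((fun=> 0) : U -> V).
  by move=> c x y; rewrite scaler0 addr0.
have [b bE] := exists_bilinear (fun=> lin0 A) (fun=> lin0 B).
have [z zE] := exists_linear (lin0 T).
have [_ uniq] := banach_tensor_alg H b.
by rewrite -gE (uniq g z) ?zE // => x y; rewrite bE ?gE ?f0 ?zE.
Qed.

(** Uniqueness in the universal property gives zero on the range of [iota], and boundedness extends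
    this by density. Identities in [AB] are thereby checked on elementary tensors. *)
Lemma banach_tensor_linear_eq0 (V : normedModType R[i]) (F : AB -> V) (M : R) :
    linear F -> (forall z, rnorm (F z) <= M * rnorm z) ->
    (forall x y, F (iota (tens x y)) = 0) ->
  forall z, F z = 0.
Proof.
move=> Fl FM F0 z.
have Fi : forall t, F (iota t) = 0.
  apply: tensor_linear_eq0 => // c s t.
  by rewrite linearP Fl.
apply: (@small_eq0 _ _ _ `|M|) => e e0.
have [t zt] := completion_approx (banach_tensor_completion H) z e0.
have -> : F z = F (z - iota t).
  have [g gE] := exists_linear Fl; rewrite -!gE raddfB.
  by rewrite -[LHS]subr0; congr (_ - _); rewrite -[LHS](Fi t) -gE.
apply: le_trans (FM _) _; apply: (@le_trans _ _ (`|M| * rnorm (z - iota t))).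
  by rewrite ler_wpM2r ?rnorm_ge0 ?ler_norm.
by rewrite ler_wpM2l // ltW.
Qed.

(* [S] is the slice map [id (x) phi]. Uniformity of the norm applied to
   [id (x) (phi (-) 1)], whose values are the [S z (x) 1], bounds it. *)
Lemma slice_map (phi : B -> R[i]) (N : R) :
    (forall (c : R[i]) x y, phi (c *: x + y) = c * phi x + phi y) ->
    (forall y, rnorm (phi y) <= N * rnorm y) ->
  exists (S : AB -> A) (M : R), [/\ linear S,
    forall z, rnorm (S z) <= M * rnorm z &
    forall x y, S (iota (tens x y)) = phi y *: x].
Proof.
move=> philin phiN.
have [f fE] : exists f : {bilinear A -> B -> A}, forall x y, f x y = phi y *: x.
  apply: (@exists_bilinear _ _ _ _ (fun x y => phi y *: x)) => [y c u v|x c u v].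
    by rewrite scalerDr !scalerA mulrC.
  by rewrite philin scalerDl scalerA.
have [[S0 S0E] _] := banach_tensor_alg H f.
have [U UE] : exists U : {linear A -> A}, U =1 id by apply: exists_linear => c u v.
have [V VE] : exists V : {linear B -> B}, V =1 (fun y => (phi y)%:A).
  by apply: exists_linear => c u v; rewrite philin scalerDl scalerA.
have [W WE] : exists W : {linear T -> T}, W =1 (fun t => tens (S0 t) 1).
  by apply: exists_linear => c u v; rewrite linearP linearPl.
have Ub : bounded_linear U by exists 1 => x; rewrite UE mul1r.
have Vb : bounded_linear V.
  exists (N * rnorm (1 : B))%:C => y; rewrite VE rnormE rnormZ.
  rewrite rnormE -rmorphM lecR mulrAC ler_wpM2r ?rnorm_ge0 //.
have WT x y : W (tens x y) = tens (U x) (V y).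
  by rewrite WE UE VE S0E fE linearZl_LR linearZr_LR.
have Wn := banach_tensor_uniform H Ub Vb WT.
set Mu := opnorm U * opnorm V in Wn.
have r1 : 0 < rnorm (1 : B) by rewrite lt_def rnorm_eq0 oner_neq0 rnorm_ge0.
(* By the crossnorm property [rnorm (W t)] is [rnorm (S0 t) * rnorm 1], whence the division. *)
have S0b t : rnorm (S0 t) <= `|Mu| / rnorm (1 : B) * rnorm t.
  have := Wn t; rewrite WE (banach_tensor_cross H) !rnormE -!rmorphM lecR => h.
  rewrite mulrAC ler_pdivlMr // (le_trans h) // ler_wpM2r ?rnorm_ge0 //.
  exact: ler_norm.
have M0 : 0 <= `|Mu| / rnorm (1 : B) by rewrite divr_ge0 // ltW.
have [S [Sl SM SE]] := completion_extend (banach_tensor_completion H)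
  (fun c u v => linearP S0 c u v) M0 S0b.
by exists S, (`|Mu| / rnorm (1 : B)); split=> // x y; rewrite SE S0E fE.
Qed.

End slice.
(** * Factors of elementary tensors *)

Section factors.
Context {R : realType} {A B AB : banachAlgType R[i]}.
Context {T : normedModType R[i]} {tens : {bilinear A -> B -> T}}.
Context {iota : {linear T -> AB}}.
Hypothesis H : is_banach_tensor tens iota.

Local Notation "x (x) y" := (iota (tens x y) : AB) (at level 40).

Let tensM x x' y y' : (x (x) y) * (x' (x) y') = (x * x') (x) (y * y').
Proof. exact: banach_tensor_mul. Qed.

Let tensDl x x' y : (x + x') (x) y = x (x) y + x' (x) y.
Proof. by rewrite linearDl linearD. Qed.

Let tensZl c x y : (c *: x) (x) y = c *: (x (x) y).
Proof. by rewrite linearZl_LR linearZ. Qed.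

Let tensDr x y y' : x (x) (y + y') = x (x) y + x (x) y'.
Proof. by rewrite linearDr linearD. Qed.

Let tensZr c x y : x (x) (c *: y) = c *: (x (x) y).
Proof. by rewrite linearZr_LR linearZ. Qed.

(** The product is prescribed on elementary tensors only; by density [1 (x) 1] is a left unit of
    [AB]. *)
Lemma tens1 : 1 (x) 1 = 1.
Proof.
have E z : (1 (x) 1) * z - z = 0.
  move: z; apply: (banach_tensor_linear_eq0 H (M := rnorm (1 (x) 1) + 1)).
  - by move=> c u v; rewrite mulrDr -scalerAr scalerBr opprD addrACA.
  - move=> w; apply: le_trans (ler_rnormD _ _) _.
    by rewrite rnormN mulrDl mul1r lerD2r rnormM_le.
  - by move=> x y; rewrite tensM !mul1r subrr.
by apply/eqP; rewrite -subr_eq0 -{1}(mulr1 (1 (x) 1)) E.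
Qed.

Lemma spectrum_tensl a : spectrum (a (x) 1) `<=` spectrum a.
Proof.
move=> mu; apply: contra => au.
have -> : a (x) 1 - mu%:A = (a - mu%:A) (x) 1.
  by rewrite -!scaleNr tensDl tensZl tens1.
apply/unitrP; exists ((a - mu%:A)^-1 (x) 1).
by rewrite !tensM mulVr // mulrV // !mul1r tens1.
Qed.

Lemma drazin_invertible_tensl a mu : drazin_invertible (a - mu%:A) ->
  drazin_invertible (a (x) 1 - mu%:A).
Proof.
have -> : a (x) 1 - mu%:A = (a - mu%:A) (x) 1.
  by rewrite -!scaleNr tensDl tensZl tens1.
set c := a - mu%:A; move=> [d [m [dm dcd cd]]].
have cX k : (c (x) 1) ^+ k = (c ^+ k) (x) 1.
  by elim: k => [|k IH]; rewrite ?tens1 // !exprS IH tensM mul1r.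
by exists (d (x) 1), m; rewrite cX !tensM !mul1r dm dcd cd.
Qed.

Lemma drazin_invertible_factorl a b (mu nu : R[i]) : nu != 0 -> spectrum b nu ->
    drazin_invertible (a (x) b - (mu * nu)%:A) ->
  drazin_invertible (a - mu%:A).
Proof.
move=> nu0 bnu.
set X := a (x) b - _; set c := a - mu%:A; pose b' := b - nu%:A.
move=> /drazin_invertibleP[Y [m [XY cXY YXY]]].
have XE : X = a (x) b' + nu *: (c (x) 1).
  rewrite /b' /c -!scaleNr tensDr tensZr tensDl tensZl tens1 scalerDr.
  by rewrite scalerA mulrN scaleNr addrA subrK scaleNr mulrC.
(* If [b'] has no right inverse, [b' B] is chosen; otherwise it has no left inverse and [B b'] is
   chosen. A member closer than 1 to [1] would be invertible and supply the missing inverse. *)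
have [J [Jsub J1 JP]] : exists J : set B, [/\ linear_subspace J,
    forall j, J j -> 1 <= rnorm (1 - j) &
    (forall u, J (b' * u)) \/ (forall u, J (u * b'))].
  have [[u bu]|nr] := pselect (exists u, b' * u = 1); last first.
    exists [set b' * u | u in setT]; split.
    - split; first by exists 0; rewrite ?mulr0.
      move=> k _ _ [u _ <-] [v _ <-]; exists (k *: u + v) => //.
      by rewrite mulrDr scalerAr.
    - move=> _ [u _ <-]; rewrite leNgt; apply/negP => /invertible_near1[w [w1 _]].
      by apply: nr; exists (u * w); rewrite mulrA.
    - by left=> u; exists u.
  exists [set u * b' | u in setT]; split.
  - split; first by exists 0; rewrite ?mul0r.
    move=> k _ _ [v _ <-] [w _ <-]; exists (k *: v + w) => //.
    by rewrite mulrDl scalerAl.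
  - move=> _ [v _ <-]; rewrite leNgt; apply/negP => /invertible_near1[w [_ w1]].
    move/negP: bnu; apply; apply/unitrP; exists u; split=> //.
    suff -> : u = w * v by rewrite -mulrA.
    by rewrite -[LHS]mul1r -w1 -!mulrA bu mulr1.
  - by right=> v; exists v.
have psn : seminorm (fun y : B => rnorm y).
  by split=> [x y|k x]; [exact: ler_rnormD|exact: rnormZ].
have qsn := quotient_seminormP psn Jsub.
(* Domination by the distance to [J] makes [phi] vanish on [J], while [rnorm (phi 1)] is at least
   the distance of [1], hence positive. *)
have [phi [philin phiq phi1]] := hahn_banach (1 : B) qsn.
have {}phi1 : phi 1 != 0.
  rewrite -rnorm_eq0 gt_eqF // (lt_le_trans _ phi1) // (lt_le_trans ltr01) //.
  by apply: quotient_seminorm_ge => // j; exact: J1.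
have phiJ j : J j -> phi j = 0.
  move=> Jj; apply/eqP; rewrite -rnorm_eq0 eq_le rnorm_ge0 andbT.
  by rewrite (le_trans (phiq _)) // quotient_seminorm_eq0.
have phiN y : rnorm (phi y) <= 1 * rnorm y.
  by rewrite mul1r (le_trans (phiq _)) // quotient_seminorm_le_base.
have [S [M [Slin SM SE]]] := slice_map H philin phiN.
have M0 : 0 <= `|M| by [].
have {}SM z : rnorm (S z) <= `|M| * rnorm z.
  by rewrite (le_trans (SM z)) // ler_wpM2r ?rnorm_ge0 ?ler_norm.
have SMM z w : rnorm (S (z * w)) <= `|M| * (rnorm z * rnorm w).
  by rewrite (le_trans (SM _)) // ler_wpM2l // rnormM_le.
(* The slice map is a morphism of [A]-bimodules, so [S Y] inherits from [Y] the commutation with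
   [a]. *)
have SA x z : S ((x (x) 1) * z) = x * S z.
  apply/eqP; rewrite -subr_eq0; apply/eqP; move: z.
  apply: (banach_tensor_linear_eq0 H (M := `|M| * rnorm (x (x) 1) + rnorm x * `|M|)).
  - move=> k u v; rewrite mulrDr -scalerAr !Slin mulrDr -scalerAr.
    by rewrite scalerBr opprD addrACA.
  - move=> z; apply: le_trans (ler_rnormD _ _) _; rewrite rnormN mulrDl lerD //.
      by rewrite -mulrA.
    by rewrite (le_trans (rnormM_le _ _)) // -mulrA ler_wpM2l ?rnorm_ge0.
  - by move=> u v; rewrite tensM mul1r !SE -scalerAr subrr.
have AS x z : S (z * (x (x) 1)) = S z * x.
  apply/eqP; rewrite -subr_eq0; apply/eqP; move: z.
  apply: (banach_tensor_linear_eq0 H (M := `|M| * rnorm (x (x) 1) + rnorm x * `|M|)).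
  - move=> k u v; rewrite mulrDl -scalerAl !Slin mulrDl -scalerAl.
    by rewrite scalerBr opprD addrACA.
  - move=> z; apply: le_trans (ler_rnormD _ _) _; rewrite rnormN mulrDl lerD //.
      by rewrite -mulrA [rnorm (x (x) 1) * _]mulrC.
    rewrite (le_trans (rnormM_le _ _)) // mulrC -mulrA ler_wpM2l ?rnorm_ge0 //.
  - by move=> u v; rewrite tensM mulr1 !SE -scalerAl subrr.
have SD z w : S (z + w) = S z + S w by have := Slin 1 z w; rewrite !scale1r.
have S0 : S 0 = 0 by apply: (addrI (S 0)); rewrite -SD !addr0.
have SZ k z : S (k *: z) = k *: S z by have := Slin k z 0; rewrite S0 !addr0.
have S1 : S 1 = (phi 1)%:A by rewrite -tens1 SE.
have SYc : GRing.comm c (S Y).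
  have aX : GRing.comm X (a (x) 1).
    apply: commr_sym; apply: commrB; first by rewrite /GRing.comm !tensM mul1r mulr1.
    by apply: commrZ; exact: commr1.
  have Ya := drazin_inverse_bicomm XY cXY YXY aX.
  apply: commr_sym; apply: commrB; last by apply: commrZ; exact: commr1.
  by rewrite /GRing.comm -SA -AS Ya.
(* This is the image under [S] of [X ^+ m = X ^+ m.+1 * Y]; division by [nu ^+ m] and [phi 1] yields
   the coefficient [(nu / phi 1) *: S Y]. *)
suff key : nu ^+ m *: (phi 1 *: c ^+ m) = nu ^+ m.+1 *: (c ^+ m.+1 * S Y).
  apply: (@drazin_invertible_comm _ _ _ ((nu / phi 1) *: S Y) m); last exact: commrZ.
  apply: (can_inj (scalerK phi1)); apply: (can_inj (scalerK (expf_neq0 m nu0))).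
  rewrite key -scalerAr !scalerA; congr (_ *: _).
  by rewrite exprS; field.
have cS k : c ^+ k * S Y = S Y * c ^+ k by apply/commr_sym/commrX/commr_sym.
case: JP => JP.
- have S_b z : S ((1 (x) b') * z) = 0.
    move: z; apply: (banach_tensor_linear_eq0 H (M := `|M| * rnorm (1 (x) b'))).
    + by move=> k u v; rewrite mulrDr -scalerAr Slin.
    + by move=> z; rewrite -mulrA.
    + by move=> u v; rewrite tensM SE phiJ ?scale0r.
  have SX z : S (X * z) = nu *: (c * S z).
    rewrite XE mulrDl SD -scalerAl SZ SA.
    by rewrite -(mulr1 b') -(mul1r a) -tensM -mulrA S_b add0r.
  have SXk k z : S (X ^+ k * z) = nu ^+ k *: (c ^+ k * S z).
    elim: k => [|k IH]; first by rewrite !mul1r scale1r.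
    by rewrite !exprS -mulrA SX IH -scalerAr scalerA mulrA.
  rewrite -SXk -XY -[X ^+ m]mulr1 SXk S1 -scalerAr mulr1; congr (_ *: _).
(* When [phi] vanishes on [B b'] everything is mirrored, starting from [Y * X ^+ m.+1 = X ^+ m]. *)
- have S_b z : S (z * (1 (x) b')) = 0.
    move: z; apply: (banach_tensor_linear_eq0 H (M := `|M| * rnorm (1 (x) b'))).
    + by move=> k u v; rewrite mulrDl -scalerAl Slin.
    + by move=> z; rewrite -mulrA [rnorm (1 (x) b') * _]mulrC.
    + by move=> u v; rewrite tensM SE phiJ ?scale0r.
  have SX z : S (z * X) = nu *: (S z * c).
    rewrite XE mulrDr SD -scalerAr SZ AS.
    by rewrite -{1}(mul1r b') -{1}(mulr1 a) -tensM mulrA S_b add0r.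
  have SXk k z : S (z * X ^+ k) = nu ^+ k *: (S z * c ^+ k).
    elim: k => [|k IH]; first by rewrite !mulr1 scale1r.
    by rewrite !exprSr mulrA SX IH -scalerAl scalerA mulrC mulrA.
  have YX : Y * X ^+ m.+1 = X ^+ m.
    by rewrite [RHS]XY; apply: commrX; exact: commr_sym.
  rewrite cS -SXk YX -[X ^+ m]mul1r SXk S1 -scalerAl mul1r; congr (_ *: _).
Qed.

End factors.

(** * Exchange of the factors and the Drazin spectrum of a tensor *)

Lemma banach_tensor_flip (R : realType) (A B AB : banachAlgType R[i])
    (T : normedModType R[i]) (tens : {bilinear A -> B -> T})
    (iota : {linear T -> AB}) : is_banach_tensor tens iota ->
  exists tens' : {bilinear B -> A -> T},
    (forall y x, tens' y x = tens x y) /\ is_banach_tensor tens' iota.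
Proof.
move=> H.
have [tens' tE] : exists t : {bilinear B -> A -> T}, forall y x, t y x = tens x y.
  apply: (@exists_bilinear _ _ _ _ (fun y x => tens x y)) => [x c u v|y c u v].
    exact: linearPr.
  exact: linearPl.
exists tens'; split=> //; split.
- move=> V f.
  have [f' fE] : exists g : {bilinear A -> B -> V}, forall x y, g x y = f y x.
    apply: (@exists_bilinear _ _ _ _ (fun x y => f y x)) => [y c u v|x c u v].
      exact: linearPr.
    exact: linearPl.
  have [[h hE] uniq] := banach_tensor_alg H f'; split.
    by exists h => y x; rewrite tE hE fE.
  by move=> h1 h2 h1E h2E; apply: uniq => x y; rewrite -tE fE.
- by move=> y x; rewrite tE (banach_tensor_cross H) mulrC.
- move=> U V W Ub Vb WE; rewrite mulrC; apply: (banach_tensor_uniform H) => // x y.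
  by rewrite -!tE WE.
- exact: banach_tensor_completion H.
- by move=> y y' x x'; rewrite !tE (banach_tensor_mul H).
Qed.

Lemma unit_drazin_invertible (K : numFieldType) (A : banachAlgType K) (x : A) :
  x \is a GRing.unit -> drazin_invertible x.
Proof.
move=> xu; exists x^-1, 0%N.
by rewrite expr0 mul1r mulVr // mulrV // mul1r.
Qed.

Lemma drazin_spectrum_sub (K : numFieldType) (A : banachAlgType K) (x : A) :
  drazin_spectrum x `<=` spectrum x.
Proof.
by move=> l nx; apply/negP => /unit_drazin_invertible.
Qed.

Lemma drazin_spectrum_poles (R : realType) (A : banachAlgType R[i]) (x : A) :
  spectrum x = poles x -> drazin_spectrum x = set0.
Proof.
move=> sp; apply/seteqP; split=> // l nx; apply: (nx).
by apply: pole_drazin_invertible; rewrite -sp; exact: drazin_spectrum_sub nx.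
Qed.

Theorem theorem4p1 (R : realType) (A B AB : banachAlgType R[i])
    (T : normedModType R[i]) (tens : {bilinear A -> B -> T})
    (iota : {linear T -> AB}) (H : is_banach_tensor tens iota)
    (a : A) (b : B) :
  let D : set R[i] := mulset (spectrum a) (drazin_spectrum b) `|`
                      mulset (drazin_spectrum a) (spectrum b) in
  let ab : AB := iota (tens a b) in
  (spectrum a = poles a -> spectrum b = poles b ->
     D = set0 /\ drazin_spectrum ab = set0) /\
  (drazin_spectrum a !=set0 \/ drazin_spectrum b !=set0 ->
     drazin_spectrum ab `\ 0 = D `\ 0 /\ drazin_spectrum ab `<=` D).
Proof.
move=> D ab; have [tens' [tE H']] := banach_tensor_flip H.
(* This inclusion serves both statements: in (i) it turns [D = set0] into the emptiness of the
   Drazin spectrum of [ab]. *)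
have sub : drazin_spectrum ab `<=` D.
  move=> l nab; apply: contrapT => nD; apply: nab.
  have tM x x' y y' := banach_tensor_mul H x x' y y'.
  have abE : ab = iota (tens a 1) * iota (tens 1 b) by rewrite tM mulr1 mul1r.
  rewrite abE; apply: drazin_invertible_mul.
    by rewrite /GRing.comm !tM !mulr1 !mul1r.
  move=> mu nu munu /(spectrum_tensl H) amu.
  rewrite -tE => /(spectrum_tensl H') bnu; rewrite tE -(tE b 1).
  split.
    apply: (drazin_invertible_tensl H); apply: contrapT => namu.
    by apply: nD; right; exists mu => //; exists nu.
  apply: (drazin_invertible_tensl H'); apply: contrapT => nbnu.
  by apply: nD; left; exists mu => //; exists nu.
split=> [sa sb|_].
  have D0 : D = set0.
    rewrite /D (drazin_spectrum_poles sa) (drazin_spectrum_poles sb).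
    by apply/seteqP; split=> // l [[mu _ [nu []]]|[mu []]].
  by split=> //; apply/seteqP; split=> // l /sub; rewrite D0.
split=> //; apply/seteqP; split=> l [lD l0]; split=> //; first exact: sub.
move=> lab; case: lD => -[mu amu [nu bnu E]]; rewrite -E in lab l0.
(* Away from [0] both factors of [l] are nonzero, so the factor lemma applies; for [b] it is used
   with the flipped tensor. *)
- have mu0 : mu != 0 by apply: contra_notN l0 => /eqP->; rewrite mul0r.
  apply: bnu; apply: (drazin_invertible_factorl H' mu0 amu).
  by rewrite tE mulrC.
- have nu0 : nu != 0 by apply: contra_notN l0 => /eqP->; rewrite mulr0.
  by apply: amu; apply: (drazin_invertible_factorl H nu0 bnu).
Qed.
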